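(* There are absolute constants $C,C'>0$ such that the following holds. Let $(\Omega,\mathcal{G},\mathbb{P})$ be the Gaussian (respectively Rademacher) measure space, let $\mathcal{H}_n$ denote the Wiener (respectively Rademacher) chaos of order $n$, and let $P_{\mathcal{H}_n}:L_2(\Omega,\mathcal{G},\mathbb{P})\to\mathcal{H}_n$ be the orthogonal projection. Then for any positive function $f\in L_2(\Omega,\mathcal{G},\mathbb{P})$ with $\|f\|_1=1$, $$\|P_{\mathcal{H}_1}f\|_2\le C\sqrt{\mathrm{Ent}(f)},\qquad \|P_{\mathcal{H}_2}f\|_2\le C'\max\{\sqrt{\mathrm{Ent}(f)},\ \mathrm{Ent}(f)\}.$$
   Context: **Entropy.** For $f\ge0$ with $\int f\,d\mathbb{P}=1$, $\mathrm{Ent}(f)=\int f\ln f\,d\mathbb{P}$. **Gaussian case.** Let $H$ be a real separable Hilbert space and $W=\{W(h):h\in H\}$ a centered Gaussian family on a probability space $(\Omega,\mathcal{F},\mathbb{P})$ with $\mathbb{E}(W(h)W(k))=\langle h,k\rangle$; $\mathcal{G}$ is the $\sigma$-algebra generated by $W$. The Wiener chaos $\mathcal{H}_n$ of order $n$ is the closed linear span in $L_2$ of $\{H_n(W(h)):h\in H,\|h\|=1\}$, where $H_n(x)=\frac{(-1)^ne^{x^2/2}}{\sqrt{n!}}\frac{d^n}{dx^n}e^{-x^2/2}$ is the $n$-th Hermite polynomial. **Rademacher case.** $\Omega=\{-1,1\}^{\mathbb{N}}$ with the product uniform probability $\mathbb{P}$ and product $\sigma$-algebra $\mathcal{G}$,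 and $\varepsilon_i$ are the coordinate functions. The Rademacher chaos of order 1 is the closed linear span of $\{\varepsilon_i:i\in\mathbb{N}\}$ in $L_2$, and that of order 2 is the closed linear span of $\{\varepsilon_i\varepsilon_j:i\ne j\}$. *)

(* Defs.v *)
From HB Require Import structures.
From mathcomp Require Import all_boot all_order all_algebra.
From mathcomp Require Import all_classical all_reals all_analysis.
Import Order.TTheory GRing.Theory Num.Theory.
Import numFieldNormedType.Exports.

Set Implicit Arguments.
Unset Strict Implicit.
Unset Printing Implicit Defensive.

Local Open Scope classical_set_scope.
Local Open Scope ring_scope.

(* A completeNormedModType whose norm comes from an inner product is a Hilbert
   space; {dot H for idfun} is a symmetric positive definite bilinear form. *)
Definition norm_from_dot (R : realType) (H : completeNormedModType R)
    (ip : {dot H for @idfun R}) : Prop :=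
  forall h : H, `|h| ^+ 2 = ip h h.

Definition separable (X : topologicalType) : Prop :=
  exists2 D : set X, countable D & dense D.

Section L2_spaces.
Context d (T : measurableType d) (R : realType) (P : probability T R).
Implicit Types (f g q : T -> R) (S M : set (T -> R)) (G : set (set T)).

(* L_2(T, G, P) for a sub-sigma-algebra G, as a set of functions rather than
   of classes of a.e. equal functions. *)
Definition L2 G : set (T -> R) :=
  [set f | f \in Lfun P 2%:E /\
           forall B : set R, measurable B -> G (f @^-1` B)].

Definition linear_span S : set (T -> R) :=
  [set q | exists (n : nat) (a : 'I_n -> R) (e : 'I_n -> T -> R),
     (forall i, S (e i)) /\ q = (fun x => \sum_(i < n) a i * e i x)].

Definition closed_span G S : set (T -> R) :=
  [set g | L2 G g /\ forall eps : R, 0 < eps ->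
     exists2 q, linear_span S q & ('N[P]_(2%:E)[EFin \o (g \- q)%R] < eps%:E)%E].

(* g is (a version of) the orthogonal projection of f onto the closed
   subspace M; by the projection theorem it exists and is a.e. unique. *)
Definition is_orth_proj M f g : Prop :=
  M g /\ forall q, M q -> ('E_P[((f \- g) \* q)%R] = 0)%E.

(* ln 0 = 0, hence the convention 0 ln 0 = 0. *)
Definition Ent f : R := \int[P]_x (f x * ln (f x)).

End L2_spaces.

Section Gaussian.
Context d (T : measurableType d) (R : realType) (P : probability T R).

(* normal_prob m 0 is not the degenerate law, hence the case s == 0. *)
Definition gaussian_rv (X : T -> R) : Prop :=
  exists m s : R, forall B : set R, measurable B ->
    P (X @^-1` B) = if s == 0 then \d_m B else normal_prob m s B.

Context (H : completeNormedModType R) (W : H -> {RV P >-> R}).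

Definition centered_gaussian_family : Prop :=
  (forall (n : nat) (a : 'I_n -> R) (h : 'I_n -> H),
     gaussian_rv (fun x => \sum_(i < n) a i * W (h i) x)) /\
  (forall h, ('E_P[W h] = 0)%E).

Definition isonormal (ip : {dot H for @idfun R}) : Prop :=
  centered_gaussian_family /\
  forall h k, ('E_P[((W h : T -> R) \* W k)%R] = (ip h k)%:E)%E.

Definition sigma_W : set (set T) :=
  <<s \bigcup_(h in [set: H]) g_sigma_algebra_preimage (W h) >>.

Definition hermite (n : nat) (x : R) : R :=
  (-1) ^+ n * expR (x ^+ 2 / 2) / Num.sqrt (n`!%:R) *
  derive1n n (fun y : R => expR (- (y ^+ 2 / 2))) x.

Definition wiener_chaos (n : nat) : set (T -> R) :=
  closed_span P sigma_W
    [set (fun x => hermite n (W h x)) | h in [set h : H | `|h| = 1]].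

End Gaussian.

(* {-1,1}^N, a sign being encoded as a boolean (true for 1, false for -1). *)
Definition sign_cylinders : set (set (nat -> bool)) :=
  \bigcup_(i in [set: nat])
    g_sigma_algebra_preimage (fun w : nat -> bool => w i).

Notation signs := (g_sigma_algebraType sign_cylinders).

Section Rademacher.
Context (R : realType).

Definition rademacher (i : nat) (w : signs) : R :=
  if (w : nat -> bool) i then 1 else -1.

Definition uniform_product (P : set signs -> \bar R) : Prop :=
  forall (n : nat) (A : 'I_n -> set bool),
    P [set w | forall i : 'I_n, A i ((w : nat -> bool) i)] =
    (\prod_(i < n) bernoulli_prob (2^-1 : R) (A i))%E.

Context (P : probability signs R).

Definition rademacher_chaos1 : set (signs -> R) :=
  closed_span P measurable [set rademacher i | i in [set: nat]].

Definition rademacher_chaos2 : set (signs -> R) :=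
  closed_span P measurable
    [set rademacher ij.1 \* rademacher ij.2
      | ij in [set ij : nat * nat | ij.1 != ij.2]].

End Rademacher.

(* Main.v *)
(** For [f >= 0] with integral 1, Young's inequality
    [a u <= a ln a - a + e^u] gives [E[f q] <= Ent f + B] as soon as
    [E e^q <= e^B].  If [E e^(t q) <= exp (k t^2 |q|^2)] for all [t >= 0], resp.
    for [t |q| <= c], then optimising in [t] bounds [E[f q]] by a multiple of
    [sqrt (Ent f) |q|], resp. [max (sqrt (Ent f)) (Ent f) |q|].  Applied to [q]
    in the linear span of a chaos approximating the projection [g] of [f], this
    bounds [|g|^2 = E[f g]], so only the exponential moments of [q] matter.

    Order 1 is (sub)Gaussian.  For the Gaussian chaos of order 2, write
    [q = sum_i a_i (X_i^2 - 1)] with [X_i = W(h_i)].  Integration by parts,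
    obtained by differentiating [E e^(s.X)], gives
    [E q^(n+2) = 2 (n+1) sum_k E[q^n Y_k^2]] for Gaussian [Y_k] with
    [2 sum_k E Y_k^2 = E q^2]; neither independence nor a diagonalisation of [q]
    is needed.  The arithmetic-geometric inequality then yields
    [E q^(2m) <= (2 m |q|)^(2m)], and one sums the exponential series.

    For the Rademacher chaos of order 2, the signs are integrated out one at a
    time in [E exp (1/2 sum M_ij e_i e_j)], using [cosh u <= exp (u^2/2)]. *)

Require Import Defs.
From mathcomp Require Import all_boot all_order all_algebra.
From mathcomp Require Import all_classical all_reals all_analysis.
From mathcomp Require Import measurable_realfun zify ring lra.
Import Order.TTheory GRing.Theory Num.Theory.
Import numFieldNormedType.Exports.

Set Implicit Arguments.
Unset Strict Implicit.
Unset Printing Implicit Defensive.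

Local Open Scope classical_set_scope.
Local Open Scope ring_scope.

Local Notation Int P X := (P.-integrable [set: _] (EFin \o X)).
Local Notation Ex P X := (Rintegral P [set: _] X).

(** * Expectation of real functions and the [L_2] norm as a real number *)

Section expectation.
Context d (T : measurableType d) (R : realType) (P : probability T R).
Implicit Types (f g q X Y : T -> R).

Lemma Int_measurable f : Int P f -> measurable_fun [set: T] f.
Proof. by move/measurable_int/measurable_EFinP. Qed.

Lemma IntD f g : Int P f -> Int P g -> Int P (fun x => f x + g x).
Proof. by move=> If Ig; have := integrableD measurableT If Ig. Qed.

Lemma IntZ (a : R) f : Int P f -> Int P (fun x => a * f x).
Proof. by move=> If; have := integrableZl measurableT a If. Qed.

Lemma IntB f g : Int P f -> Int P g -> Int P (fun x => f x - g x).
Proof. by move=> If Ig; have := integrableB measurableT If Ig. Qed.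

Lemma Int_cst (a : R) : Int P (fun=> a).
Proof. exact: finite_measure_integrable_cst. Qed.

Lemma Int_sum (I : Type) (s : seq I) (F : I -> T -> R) :
  (forall i, Int P (F i)) -> Int P (fun x => \sum_(i <- s) F i x).
Proof.
move=> IF; elim: s => [|i s IH].
  by under [X in EFin \o X]funext do rewrite big_nil; exact: Int_cst.
by under [X in EFin \o X]funext do rewrite big_cons; exact: IntD.
Qed.

Lemma Int_le f g : measurable_fun [set: T] f -> Int P g ->
  (forall x, `|f x| <= g x) -> Int P f.
Proof.
move=> mf Ig fg; apply: (le_integrable measurableT _ _ Ig).
  exact/measurable_EFinP.
by move=> x _ /=; rewrite lee_fin (le_trans (fg x))// ler_norm.
Qed.

Lemma ExD f g : Int P f -> Int P g ->
  Ex P (fun x => f x + g x) = Ex P f + Ex P g.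
Proof. by move=> If Ig; rewrite RintegralD. Qed.

Lemma ExB f g : Int P f -> Int P g ->
  Ex P (fun x => f x - g x) = Ex P f - Ex P g.
Proof. by move=> If Ig; rewrite RintegralB. Qed.

Lemma ExZ (a : R) f : Int P f -> Ex P (fun x => a * f x) = a * Ex P f.
Proof. by move=> If; rewrite RintegralZl. Qed.

Lemma Ex_cst (a : R) : Ex P (fun=> a) = a.
Proof. by rewrite Rintegral_cst//= probability_setT mulr1. Qed.

Lemma Ex_sum (I : Type) (s : seq I) (F : I -> T -> R) :
  (forall i, Int P (F i)) ->
  Ex P (fun x => \sum_(i <- s) F i x) = \sum_(i <- s) Ex P (F i).
Proof.
move=> IF; elim: s => [|i s IH].
  rewrite big_nil -[RHS](Ex_cst 0); congr (Ex P _); apply/funext => x.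
  by rewrite big_nil.
rewrite big_cons -IH -ExD//; last exact: Int_sum.
by congr (Ex P _); apply/funext => x; rewrite big_cons.
Qed.

Lemma Ex_le f g : Int P f -> Int P g -> (forall x, f x <= g x) ->
  Ex P f <= Ex P g.
Proof. by move=> If Ig fg; apply: le_Rintegral. Qed.

(** Replacing [g] by [max f g], which is a.e. equal to it, reduces to an inequality that holds
    everywhere. *)
Lemma Ex_le_ae f g : Int P f -> Int P g -> {ae P, forall x, f x <= g x} ->
  Ex P f <= Ex P g.
Proof.
move=> If Ig fg; rewrite -lee_fin.
have fE h : Int P h -> (Ex P h)%:E = (\int[P]_x (h x)%:E)%E.
  by move=> Ih; rewrite fineK//; exact: (integrable_fin_num measurableT Ih).
rewrite !fE//; have [/measurable_EFinP mf mg] := (Int_measurable If, Int_measurable Ig).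
pose h x := Num.max (f x) (g x).
have mh : measurable_fun [set: T] h by apply: measurable_maxr => //; exact/measurable_EFinP.
have -> : (\int[P]_x (g x)%:E = \int[P]_x (h x)%:E)%E.
  apply: ae_eq_integral => //; [exact/measurable_EFinP..|].
  by apply: filterS fg => x /= fgx _; rewrite /h (max_idPr _).
apply: le_integral => //; last by move=> x _; rewrite lee_fin le_max lexx.
apply: (Int_le mh (g := fun x => `|f x| + `|g x|)).
  by apply: IntD; exact: integrable_norm.
move=> x; rewrite /h; case: (leP (f x) (g x)) => _; last by rewrite lerDl.
by rewrite lerDr.
Qed.

Lemma Ex_ge0 f : (forall x, 0 <= f x) -> 0 <= Ex P f.
Proof. by move=> f0; apply: Rintegral_ge0. Qed.

Lemma ExE f : Int P f -> (Ex P f)%:E = (\int[P]_x (f x)%:E)%E.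
Proof. by move=> If; rewrite fineK//; exact: (integrable_fin_num measurableT If). Qed.

Lemma norm_Ex f : Int P f -> `|Ex P f| <= Ex P (fun x => `|f x|).
Proof. by move=> If; apply: le_normr_Rintegral. Qed.

Lemma ge0_Int f : measurable_fun [set: T] f -> (forall x, 0 <= f x) ->
  (\int[P]_x (f x)%:E < +oo)%E -> Int P f.
Proof.
move=> mf f0 foo; apply/integrableP; split; first exact/measurable_EFinP.
by under eq_integral do rewrite /= ger0_norm//.
Qed.

Lemma Lfun2P f : f \in Lfun P 2%:E <->
  measurable_fun [set: T] f /\ Int P (fun x => f x ^+ 2).
Proof.
split.
  move=> lf; split; last exact: Lfun2_integrable_sqr.
  by move: lf; rewrite inE => /andP[/[!inE]].
move=> [mf If]; rewrite inE; apply/andP; split; rewrite inE//=.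
rewrite /finite_norm unlock poweR_lty//.
under eq_integral do rewrite /= powR_mulrn// -normrX.
by have /integrableP[_] := If.
Qed.

Lemma Lfun2_IntM f g : f \in Lfun P 2%:E -> g \in Lfun P 2%:E ->
  Int P (fun x => f x * g x).
Proof. by move=> lf lg; apply/Lfun1_integrable; exact: Lfun2_mul_Lfun1. Qed.

Lemma Lfun2_Int f : f \in Lfun P 2%:E -> Int P f.
Proof.
move=> lf; apply/Lfun1_integrable.
exact: (Lfun_subset12 (fin_num_measure P _ measurableT) lf).
Qed.

Lemma Lfun2B f g : f \in Lfun P 2%:E -> g \in Lfun P 2%:E ->
  (fun x => f x - g x) \in Lfun P 2%:E.
Proof.
move=> /Lfun2P[mf If] /Lfun2P[mg Ig]; apply/Lfun2P.
have mfg : measurable_fun [set: T] (fun x => f x - g x) by exact: measurable_funB.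
split=> //; apply: (Int_le (g := fun x => 2 * f x ^+ 2 + 2 * g x ^+ 2)).
- exact: measurable_funX.
- by apply: IntD; exact: IntZ.
- move=> x; rewrite ger0_norm ?sqr_ge0//.
  by have := sqr_ge0 (f x + g x); nra.
Qed.

Definition norm2 f : R := Num.sqrt (Ex P (fun x => f x ^+ 2)).

Lemma norm2_ge0 f : 0 <= norm2 f. Proof. exact: sqrtr_ge0. Qed.

Lemma sqr_norm2 f : norm2 f ^+ 2 = Ex P (fun x => f x ^+ 2).
Proof. by rewrite sqr_sqrtr// Ex_ge0// => x; exact: sqr_ge0. Qed.

Lemma Lnorm2E f : f \in Lfun P 2%:E -> 'N[P]_(2%:E)[EFin \o f]%E = (norm2 f)%:E.
Proof.
move=> /Lfun2P[mf If]; rewrite unlock /norm2 -powR12_sqrt; last first.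
  by apply: Ex_ge0 => x; exact: sqr_ge0.
rewrite -poweR_EFin ExE//; congr (_ `^ _)%E; apply: eq_integral => x _.
by rewrite /= powR_mulrn// -normrX ger0_norm ?sqr_ge0.
Qed.

Lemma cauchy_schwarz f g : f \in Lfun P 2%:E -> g \in Lfun P 2%:E ->
  `|Ex P (fun x => f x * g x)| <= norm2 f * norm2 g.
Proof.
move=> lf lg; have Ifg := Lfun2_IntM lf lg.
rewrite -lee_fin EFinM -!Lnorm2E//.
have mf : measurable_fun [set: T] f by case/Lfun2P: lf.
have mg : measurable_fun [set: T] g by case/Lfun2P: lg.
apply: le_trans (hoelder P (p := 2) (q := 2) mf mg _ _ _) => //; last first.
  by rewrite [RHS]splitr !div1r.
rewrite Lnorm1 (le_trans (y := (Ex P (fun x => `|f x * g x|))%:E))//.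
  by rewrite lee_fin norm_Ex.
by rewrite ExE//; exact: (integrable_norm Ifg).
Qed.

End expectation.

(** * Entropy duality *)

Section entropy.
Context d (T : measurableType d) (R : realType) (P : probability T R).
Implicit Types (f g q X Y : T -> R).

(** The tangent inequality [1 + v <= e^v] at [v = u - ln a], multiplied by [a]; for [a = 0] it reads
    [0 <= e^u]. *)
Lemma mul_le_entropy (a u : R) : 0 <= a -> a * u <= a * ln a - a + expR u.
Proof.
rewrite le_eqVlt => /predU1P[<-|a0]; first by rewrite !mul0r subr0 add0r expR_ge0.
have := expR_ge1Dx (u - ln a); rewrite expRD expRN lnK ?posrE// => h.
have := ler_wpM2l (ltW a0) h.
by rewrite mulrCA mulfV ?gt_eqF// mulr1; lra.
Qed.

(** Makes [f ln f] integrable for [f] in [L_2]. For [a > 0] the upper bound uses [ln a <= a - 1] and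
    the lower one is Young's inequality at [u = 0]; for [a <= 0] the product is [0], as [ln]
    vanishes there. *)
Lemma norm_mul_ln (a : R) : `|a * ln a| <= 1 + a ^+ 2.
Proof.
have [a0|a0] := leP a 0; first by rewrite ln0// mulr0 normr0 addr_ge0// sqr_ge0.
have h1 : ln a <= a - 1.
  by have := ln_sublinear a0; have := expR_ge1Dx (ln a); rewrite lnK ?posrE//; lra.
have h2 : a - 1 <= a * ln a by have := mul_le_entropy 0 (ltW a0); rewrite mulr0 expR0; lra.
rewrite ler_norml; apply/andP; split; first by nra.
by have := ler_wpM2l (ltW a0) h1; nra.
Qed.

Lemma norm2_le_add_dist f g : f \in Lfun P 2%:E -> g \in Lfun P 2%:E ->
  norm2 P g <= norm2 P f + norm2 P (fun x => f x - g x).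
Proof.
move=> lf lg.
have lfg : (fun x => f x - g x) \in Lfun P 2%:E by exact: Lfun2B.
rewrite -ler_sqr ?nnegrE ?addr_ge0 ?norm2_ge0//.
have /Lfun2P[_ If2] := lf; have /Lfun2P[_ Ig2] := lg; have /Lfun2P[_ Ifg2] := lfg.
have := cauchy_schwarz lf lfg; rewrite ler_norml => /andP[cs _].
rewrite sqrrD !sqr_norm2.
have -> : Ex P (fun x => g x ^+ 2) = Ex P (fun x => f x ^+ 2)
    + (- 2) * Ex P (fun x => f x * (f x - g x)) + Ex P (fun x => (f x - g x) ^+ 2).
  have Ifg := Lfun2_IntM lf lfg.
  have I2 := IntZ (- 2) Ifg; have I3 := IntD If2 I2.
  rewrite -ExZ// -!ExD//.
  by congr (Ex P _); apply/funext => x; ring.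
by move: cs; rewrite mulr2n; nra.
Qed.

Section density.
Variable f : T -> R.
Hypothesis lf : f \in Lfun P 2%:E.
Hypothesis f_ge0 : {ae P, forall x, 0 <= f x}.
Hypothesis f_norm1 : 'N[P]_1[EFin \o f]%E = 1%E.

Lemma Int_mul_ln : Int P (fun x => f x * ln (f x)).
Proof.
have /Lfun2P[mf If] := lf.
apply: (Int_le (g := fun x => 1 + f x ^+ 2)).
- by apply: measurable_funM => //; exact: (measurableT_comp (@measurable_ln R)).
- by apply: IntD => //; exact: Int_cst.
- by move=> x; exact: norm_mul_ln.
Qed.

Lemma Ex_density : Ex P f = 1.
Proof.
have If := Lfun2_Int lf.
apply: EFin_inj; rewrite ExE// -f_norm1 Lnorm1; apply: ae_eq_integral => //.
- exact: measurable_int If.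
- exact/measurableT_comp/(measurable_int _ If).
- by apply: filterS f_ge0 => x fx _ /=; rewrite ger0_norm.
Qed.

(** Young's inequality is applied pointwise with [u = q - B]; after integration the remainder
    [- E f + e^(-B) E e^q] is at most [-1 + 1 = 0]. *)
Lemma entropy_duality q (B : R) : q \in Lfun P 2%:E ->
  Int P (fun x => expR (q x)) -> Ex P (fun x => expR (q x)) <= expR B ->
  Ex P (fun x => f x * q x) <= Ent P f + B.
Proof.
move=> lq Ie EB.
have If := Lfun2_Int lf; have Ifq := Lfun2_IntM lf lq; have Il := Int_mul_ln.
have Ife := IntZ (expR (- B)) Ie.
have h : Ex P (fun x => f x * q x - B * f x) <=
  Ex P (fun x => f x * ln (f x) - f x + expR (- B) * expR (q x)).
  apply: Ex_le_ae.
  - by apply: IntB => //; exact: IntZ.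
  - by apply: IntD => //; exact: IntB.
  - apply: filterS f_ge0 => x fx; rewrite -expRD.
    by have := mul_le_entropy (- B + q x) fx; nra.
move: h; rewrite ExB//; last exact: IntZ.
rewrite ExD//; last exact: IntB.
rewrite ExB// !ExZ// Ex_density /Ent.
have : expR (- B) * Ex P (fun x => expR (q x)) <= 1.
  have := ler_wpM2l (expR_ge0 (- B)) EB.
  by rewrite -[leRHS]expRD addNr expR0.
lra.
Qed.

(** Duality with [q = 0] and [B = 0]. *)
Lemma Ent_ge0 : 0 <= Ent P f.
Proof.
have /(_ 0) := @entropy_duality (cst 0) _ (Lfun_cst P 0 2).
rewrite addr0 /= expR0 => h.
have /h : Int P (fun _ : T => (1 : R)) by exact: Int_cst.
rewrite Ex_cst lexx => /(_ isT); congr (_ <= _).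
by rewrite -[RHS](Ex_cst P 0); congr (Ex P _); apply/funext => x; rewrite mulr0.
Qed.

(** Orthogonality tested on [g] itself gives [E[f g] = |g|^2]; Cauchy-Schwarz controls the error
    made when [g] is replaced by an element of the span, to which the hypothesis applies. *)
Lemma proj_norm2_le (S : set (T -> R)) G g (k : R) : 0 <= k ->
  (forall q, linear_span S q ->
    q \in Lfun P 2%:E /\ Ex P (fun x => f x * q x) <= k * norm2 P q) ->
  is_orth_proj P (closed_span P G S) f g ->
  ('N[P]_(2%:E)[EFin \o g] <= k%:E)%E.
Proof.
move=> k0 hS [[[lg lgm] app] orth].
have Eg : Ex P (fun x => f x * g x) = norm2 P g ^+ 2.
  have /= := orth g (conj (conj lg lgm) app).
  rewrite unlock => /(congr1 fine) /= E.
  apply/eqP; rewrite -subr_eq0 sqr_norm2 -ExB//; last 2 first.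
    exact: Lfun2_IntM.
    by have /Lfun2P[] := lg.
  apply/eqP; rewrite -[RHS]E /Rintegral; congr fine; apply: eq_integral => x _.
  by rewrite mulrBl expr2.
rewrite Lnorm2E// lee_fin leNgt; apply/negP => kg.
have [n0 F0] : 0 <= norm2 P g /\ 0 <= norm2 P f by rewrite !norm2_ge0.
set n := norm2 P g in kg n0 Eg *; set F := norm2 P f in F0 *.
(* If [n > k], this tolerance makes the total error [(k + F) e] smaller than [n (n - k)], which
   contradicts [n^2 <= k (n + e) + F e]. *)
pose e := n * (n - k) / (2 * (k + F + 1)).
have D0 : 0 < 2 * (k + F + 1) by lra.
have e0 : 0 < e by rewrite /e divr_gt0// mulr_gt0//; lra.
have [q Sq] := app _ e0.
have [lq fq] := hS q Sq.
have lgq : (fun x => g x - q x) \in Lfun P 2%:E by exact: Lfun2B.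
rewrite (Lnorm2E lgq) lte_fin => gqe.
have qn : norm2 P q <= n + e.
  by have := norm2_le_add_dist lg lq; rewrite -/n; lra.
have fgq : Ex P (fun x => f x * (g x - q x)) <= F * e.
  apply: le_trans (ler_norm _) _; apply: le_trans (cauchy_schwarz lf lgq) _.
  by rewrite ler_wpM2l// ltW.
have : n ^+ 2 <= k * (n + e) + F * e.
  rewrite -Eg (_ : Ex P _ = Ex P (fun x => f x * q x) + Ex P (fun x => f x * (g x - q x))).
    by rewrite lerD// (le_trans fq)// ler_wpM2l.
  rewrite -ExD; [|exact: Lfun2_IntM..].
  by congr (Ex P _); apply/funext => x; rewrite mulrBr addrC subrK.
have : e * (2 * (k + F + 1)) = n * (n - k) by rewrite /e divfK// gt_eqF.
have : 0 < n * (n - k) by apply: mulr_gt0; lra.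
nra.
Qed.

End density.
End entropy.

(** * Optimisation in the parameter [t] *)

Section real_optimization.
Context (R : realType).
Implicit Types x s k c n : R.

(** The degenerate cases, where the optimal [t] would be zero or infinite. If [n = 0], every [t] is
    admissible and a large one excludes [x > 0]; if [s = 0 < n], a small one does, the right side
    being quadratic in [t]. *)
Lemma le0_of_mul_le_sqr x s k c n : 0 <= s -> 0 < k -> 0 < c -> 0 <= n ->
  (forall t, 0 <= t -> t * n <= c -> t * x <= s ^+ 2 + k * t ^+ 2 * n ^+ 2) ->
  s * n = 0 -> x <= 0.
Proof.
move=> s0 k0 c0 n0 h /eqP; rewrite mulf_eq0 leNgt => /orP sn; apply/negP => x0.
have [nE|nN] := eqVneq n 0.
  have := h ((s ^+ 2 + 1) / x); rewrite nE expr0n !mulr0 addr0 divfK ?gt_eqF//.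
  have t0 : 0 <= (s ^+ 2 + 1) / x by rewrite divr_ge0 ?addr_ge0 ?sqr_ge0// ltW.
  by move=> /(_ t0 (ltW c0)); rewrite gerDl ler10.
have {}n0 : 0 < n by rewrite lt_neqAle eq_sym nN.
have {sn}s00 : s = 0 by case: sn => /eqP// nE; rewrite nE eqxx in nN.
pose t := Num.min (c / n) (x / (2 * k * n ^+ 2)).
have kn0 : 0 < 2 * k * n ^+ 2 by rewrite !mulr_gt0// exprn_gt0.
have t0 : 0 < t by rewrite lt_min !divr_gt0.
have tc : t * n <= c by rewrite -ler_pdivlMr// ge_min lexx.
have tx : t * (2 * k * n ^+ 2) <= x by rewrite -ler_pdivlMr// ge_min lexx orbT.
have := h t (ltW t0) tc; rewrite s00 expr0n add0r.
rewrite (_ : k * t ^+ 2 * _ = t * (k * t * n ^+ 2)); last by ring.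
rewrite ler_pM2l//; nra.
Qed.

(** With [s = sqrt e], the choice [t = s / n] makes both terms on the right multiples of [s^2]. *)
Lemma le_of_mul_le_sqr x e k n : 0 <= e -> 0 < k -> 0 <= n ->
  (forall t, 0 <= t -> t * x <= e + k * t ^+ 2 * n ^+ 2) ->
  x <= (1 + k) * Num.sqrt e * n.
Proof.
move=> e0 k0 n0; rewrite -{1}(sqr_sqrtr e0); have := sqrtr_ge0 e.
move: (Num.sqrt e) => s s0 h.
have [sn|sn] := eqVneq (s * n) 0.
  by rewrite -mulrA sn mulr0 (@le0_of_mul_le_sqr x s k 1 n)// => t t0 _; exact: h.
move: sn; rewrite mulf_eq0 negb_or => /andP[sN nN].
have {}n0 : 0 < n by rewrite lt_neqAle eq_sym nN.
have {}s0 : 0 < s by rewrite lt_neqAle eq_sym sN.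
have := h (s / n) (ltW (divr_gt0 s0 n0)).
rewrite -(ler_pM2l (divr_gt0 n0 s0)) (_ : n / s * (s / n * x) = x); last by field; exact/andP.
by congr (_ <= _); field; exact/andP.
Qed.

(** The constraint creates two regimes for [s = sqrt e]. If [s <= 1], then [t = c s / n] is
    admissible and gives a bound linear in [s]; otherwise the largest admissible value [t = c / n]
    gives [(s^2 / c + k c) n], and [1 < s^2] finishes. *)
Lemma le_of_mul_le_sqr_bounded x e k c n : 0 <= e -> 0 < k -> 0 < c -> 0 <= n ->
  (forall t, 0 <= t -> t * n <= c -> t * x <= e + k * t ^+ 2 * n ^+ 2) ->
  x <= (c^-1 + k * c) * Num.max (Num.sqrt e) e * n.
Proof.
move=> e0 k0 c0 n0; rewrite -{1 3}(sqr_sqrtr e0); have := sqrtr_ge0 e.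
move: (Num.sqrt e) => s s0 h.
have C0 : 0 < c^-1 + k * c by rewrite addr_gt0 ?invr_gt0 ?mulr_gt0.
have [sn|sn] := eqVneq (s * n) 0.
  apply: le_trans (le0_of_mul_le_sqr s0 k0 c0 n0 h sn) _.
  by rewrite !mulr_ge0 ?(ltW C0)// le_max s0.
move: sn; rewrite mulf_eq0 negb_or => /andP[sN nN].
have {}n0 : 0 < n by rewrite lt_neqAle eq_sym nN.
have {}s0 : 0 < s by rewrite lt_neqAle eq_sym sN.
have cN : c != 0 by rewrite gt_eqF.
have [s1|s1] := leP s 1.
  apply: (@le_trans _ _ ((c^-1 + k * c) * s * n)); last first.
    by rewrite ler_pM2r// ler_pM2l// le_max lexx.
  have := h (c * s / n) (ltW (divr_gt0 (mulr_gt0 c0 s0) n0)).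
  rewrite divfK// -[leRHS]mulr1 ler_pM2l// => /(_ s1).
  rewrite -(ler_pM2l (divr_gt0 n0 (mulr_gt0 c0 s0))).
  rewrite (_ : n / (c * s) * (c * s / n * x) = x); last by field; exact/and3P.
  by congr (_ <= _); field; exact/and3P.
apply: (@le_trans _ _ ((c^-1 + k * c) * s ^+ 2 * n)); last first.
  by rewrite ler_pM2r// ler_pM2l// le_max lexx orbT.
have := h (c / n) (ltW (divr_gt0 c0 n0)); rewrite divfK// => /(_ (lexx _)).
rewrite -(ler_pM2l (divr_gt0 n0 c0)).
rewrite (_ : n / c * (c / n * x) = x); last by field; exact/andP.
move=> /le_trans; apply.
rewrite (_ : n / c * _ = (s ^+ 2 / c + k * c) * n); last by field; exact/andP.
rewrite ler_pM2r// mulrDl (mulrC c^-1) lerD2l ler_peMr ?mulr_ge0 ?ltW//.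
by rewrite exprn_egt1.
Qed.

End real_optimization.

(** * Exponential moments and first-order expansions *)

Section tame.
Context d (T : measurableType d) (R : realType) (P : probability T R).
Implicit Types (f g q X Y : T -> R).

(** Finiteness of all absolute moments defines an algebra of functions, so that integrability of
    polynomial expressions follows by closure. *)
Definition tame f : Prop :=
  measurable_fun [set: T] f /\ forall n : nat, Int P (fun x => `|f x| ^+ n).

Lemma tame_measurable f : tame f -> measurable_fun [set: T] f.
Proof. by case. Qed.

Lemma tame_Int f : tame f -> Int P f.
Proof.
by move=> [mf /(_ 1%N) If]; apply: (Int_le mf If) => x; rewrite expr1.
Qed.

Lemma tame_Lfun2 f : tame f -> f \in Lfun P 2%:E.
Proof.
move=> [mf /(_ 2%N) If]; apply/Lfun2P; split => //.
by under [X in EFin \o X]funext do rewrite -real_normK ?num_real//.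
Qed.

Lemma tame_le f g : measurable_fun [set: T] f -> tame g ->
  (forall x, `|f x| <= g x) -> tame f.
Proof.
move=> mf [mg Ig] fg; split=> // n; apply: (Int_le _ (Ig n)) => [|x].
  by apply: measurable_funX; exact: measurableT_comp.
rewrite normrX normr_id lerXn2r ?nnegrE ?normr_ge0//.
by rewrite (le_trans (fg x))// ler_norm.
Qed.

Lemma tame_cst (a : R) : tame (fun=> a).
Proof. by split=> // n; exact: Int_cst. Qed.

Lemma tame_norm f : tame f -> tame (fun x => `|f x|).
Proof.
move=> [mf If]; split; first exact: measurableT_comp.
by move=> n; under [X in EFin \o X]funext do rewrite normr_id.
Qed.

Lemma tameM f g : tame f -> tame g -> tame (fun x => f x * g x).
Proof.
move=> [mf If] [mg Ig]; split; first exact: measurable_funM.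
move=> n; apply: (Int_le _ (IntD (If (n * 2)%N) (Ig (n * 2)%N))) => [|x].
  by apply: measurable_funX; apply: measurableT_comp => //; exact: measurable_funM.
rewrite normrX normr_id normrM exprMn !exprM.
have [a0 b0] : 0 <= `|f x| ^+ n /\ 0 <= `|g x| ^+ n by rewrite !exprn_ge0.
by have := sqr_ge0 (`|f x| ^+ n - `|g x| ^+ n); nra.
Qed.

Lemma tameD f g : tame f -> tame g -> tame (fun x => f x + g x).
Proof.
move=> tf tg; have [mf If] := tf; have [mg Ig] := tg.
split; first exact: measurable_funD.
move=> n; apply: (Int_le _ (IntD (IntZ (2 ^+ n) (If n)) (IntZ (2 ^+ n) (Ig n)))) => [|x].
  by apply: measurable_funX; apply: measurableT_comp => //; exact: measurable_funD.
rewrite normrX normr_id -!exprMn.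
have : `|f x + g x| <= 2 * Num.max `|f x| `|g x|.
  apply: le_trans (ler_normD _ _) _.
  by rewrite mulr2n mulrDl mul1r lerD// le_max lexx ?orbT.
move=> /(lerXn2r n) h; apply: le_trans (h _ _) _; rewrite ?nnegrE ?mulr_ge0 ?le_max ?normr_ge0//.
by have [_|_] := leP `|f x| `|g x|; rewrite ?lerDr ?lerDl exprn_ge0// mulr_ge0.
Qed.

Lemma tameZ (a : R) f : tame f -> tame (fun x => a * f x).
Proof. by apply: tameM; exact: tame_cst. Qed.

Lemma tameB f g : tame f -> tame g -> tame (fun x => f x - g x).
Proof.
move=> tf tg; under [X in tame X]funext do rewrite -mulN1r.
by apply: tameD => //; exact: tameZ.
Qed.

Lemma tame_sum (I : Type) (s : seq I) (F : I -> T -> R) :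
  (forall i, tame (F i)) -> tame (fun x => \sum_(i <- s) F i x).
Proof.
move=> tF; elim: s => [|i s IH].
  by under [X in tame X]funext do rewrite big_nil; exact: tame_cst.
by under [X in tame X]funext do rewrite big_cons; exact: tameD.
Qed.

Lemma tameX f n : tame f -> tame (fun x => f x ^+ n).
Proof.
move=> tf; elim: n => [|n IH]; first exact: tame_cst.
by under [X in tame X]funext do rewrite exprS; exact: tameM.
Qed.

Definition exp_tame Y : Prop :=
  measurable_fun [set: T] Y /\ forall t : R, Int P (fun x => expR (t * Y x)).

Lemma exp_tameZ (a : R) Y : exp_tame Y -> exp_tame (fun x => a * Y x).
Proof.
move=> [mY IY]; split; first exact: measurable_funM.
by move=> t; under [X in EFin \o X]funext do rewrite mulrA.
Qed.

Lemma exp_tame_expR Y : exp_tame Y -> tame (fun x => expR (Y x)).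
Proof.
move=> [mY IY]; split; first exact: (measurableT_comp (@measurable_expR R)).
move=> n; under [X in EFin \o X]funext do rewrite ger0_norm ?expR_ge0// -expRM_natl.
exact: IY.
Qed.

(** Both signs of the parameter enter, through [e^|Y| <= e^Y + e^(-Y)]. *)
Lemma exp_tame_expR_norm Y : exp_tame Y -> tame (fun x => expR `|Y x|).
Proof.
move=> eY; have [mY _] := eY.
apply: (@tame_le _ (fun x => expR (Y x) + expR (-1 * Y x))).
- by apply: (measurableT_comp (@measurable_expR R)); exact: measurableT_comp.
- by apply: tameD; apply: exp_tame_expR => //; exact: exp_tameZ.
- move=> x; rewrite ger0_norm ?expR_ge0// mulN1r.
  by case: (ger0P (Y x)) => _; rewrite ?lerDl ?lerDr expR_ge0.
Qed.

Lemma exp_tame_tame Y : exp_tame Y -> tame Y.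
Proof.
move=> eY; apply: tame_le (exp_tame_expR_norm eY) _; first by case: eY.
by move=> x; have := expR_ge1Dx `|Y x|; lra.
Qed.

End tame.

Section jet.
Context (R : realType).
Implicit Types (u v : R -> R) (a b t : R).

(** A quantitative form of [u 0 = a] and [u' 0 = b]; a quadratic remainder on [[-1, 1]] passes
    through expectations by a plain bound. *)
Definition jet u a b : Prop :=
  exists C, forall t, `|t| <= 1 -> `|u t - a - b * t| <= C * t ^+ 2.

Lemma eq_jet u v a b : u =1 v -> jet u a b -> jet v a b.
Proof. by move=> uv [C h]; exists C => t /h; rewrite uv. Qed.

(** At [t = 0] both constants equal [u 0]; then [|b - b'| t <= (C + C') t^2] fails for small [t > 0]
    unless [b = b']. Moment identities are extracted this way, by expanding one function of [t]
    twice. *)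
Lemma jet_uniq u a b a' b' : jet u a b -> jet u a' b' -> a = a' /\ b = b'.
Proof.
move=> [C h] [C' h'].
have aE : a = a'.
  have := h 0; have := h' 0.
  rewrite normr0 ler01 !mulr0 !subr0 expr0n !mulr0 !normr_le0 => /(_ isT)/eqP ? /(_ isT)/eqP ?.
  by lra.
split=> //; apply/eqP; rewrite -subr_eq0 -normr_le0 leNgt; apply/negP.
rewrite aE in h *; move eE : `|b - b'| => e e0.
have C0 : 0 <= C by have := h 1; rewrite normr1 lexx expr1n !mulr1 => /(_ isT); apply: le_trans.
have C0' : 0 <= C' by have := h' 1; rewrite normr1 lexx expr1n !mulr1 => /(_ isT); apply: le_trans.
pose t := Num.min 1 (e / (2 * (C + C' + 1))).
have D0 : 0 < 2 * (C + C' + 1) by lra.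
have t0 : 0 < t by rewrite lt_min ltr01 divr_gt0.
have t1 : `|t| <= 1 by rewrite gtr0_norm// ge_min lexx.
have te : t * (2 * (C + C' + 1)) <= e by rewrite -ler_pdivlMr// ge_min lexx orbT.
have : e * t <= (C + C') * t ^+ 2.
  rewrite -eE -{1}(gtr0_norm t0) -normrM.
  have -> : (b - b') * t = (u t - a' - b' * t) - (u t - a' - b * t) by ring.
  by apply: le_trans (ler_normB _ _) _; rewrite addrC mulrDl lerD ?h ?h'.
rewrite expr2 mulrA ler_pM2r//; nra.
Qed.

Lemma jetD u v a b a' b' : jet u a b -> jet v a' b' ->
  jet (fun t => u t + v t) (a + a') (b + b').
Proof.
move=> [C h] [C' h']; exists (C + C') => t t1; rewrite (mulrDl C).
have -> : u t + v t - (a + a') - (b + b') * t =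
  (u t - a - b * t) + (v t - a' - b' * t) by ring.
by apply: le_trans (ler_normD _ _) _; rewrite lerD ?h ?h'.
Qed.

Lemma jetZ (k : R) u a b : jet u a b -> jet (fun t => k * u t) (k * a) (k * b).
Proof.
move=> [C h]; exists (`|k| * C) => t t1.
rewrite (_ : _ - _ - _ = k * (u t - a - b * t)); last by ring.
by rewrite normrM -mulrA ler_wpM2l ?h.
Qed.

Lemma jetM_id u a b : jet u a b -> jet (fun t => t * u t) 0 a.
Proof.
move=> [C h]; exists (C + `|b|) => t t1.
have -> : t * u t - 0 - a * t = t * (u t - a - b * t) + b * t ^+ 2 by ring.
apply: le_trans (ler_normD _ _) _; rewrite mulrDl !normrM.
rewrite -expr2 real_normK ?num_real// lerD2r.
have := ler_pM (normr_ge0 _) (normr_ge0 _) t1 (h t t1).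
by rewrite mul1r.
Qed.

(** For [t < 1] this rests on [(1 - t) e^t <= 1]; for [t >= 1] the right side is at least [e^t]. *)
Lemma expR_taylor1 t : `|expR t - 1 - t| <= t ^+ 2 * expR `|t|.
Proof.
rewrite ger0_norm; last by have := expR_ge1Dx t; lra.
have hN : (1 - t) * expR t <= 1.
  have := ler_wpM2r (expR_ge0 t) (expR_ge1Dx (- t)).
  by rewrite -expRD addNr expR0.
case: (ger0P t) => t0.
  have [t1|t1] := leP 1 t; last by nra.
  have := expR_ge0 t; nra.
have h1 : 1 <= expR (- t) by rewrite -(expR0 R) ler_expR; lra.
suff : expR t - 1 - t <= t ^+ 2 by have := sqr_ge0 t; nra.
nra.
Qed.

Lemma jet_expR_quad a b c : jet (fun t => expR (a + b * t + c * t ^+ 2)) (expR a) (b * expR a).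
Proof.
exists (expR a * ((`|b| + `|c|) ^+ 2 * expR (`|b| + `|c|) + `|c|)) => t t1.
have tt : t ^+ 2 <= `|t|.
  by rewrite -real_normK ?num_real// expr2 ler_piMl.
rewrite (_ : expR (a + _ + _) = expR a * expR (b * t + c * t ^+ 2)); last first.
  by rewrite -expRD addrA.
rewrite (_ : _ - _ - _ = expR a * ((expR (b * t + c * t ^+ 2) - 1
  - (b * t + c * t ^+ 2)) + c * t ^+ 2)); last by ring.
rewrite normrM ger0_norm ?expR_ge0// -mulrA ler_wpM2l ?expR_ge0//.
apply: le_trans (ler_normD _ _) _; rewrite mulrDl lerD//; last first.
  by rewrite normrM [`|t ^+ 2|]ger0_norm ?sqr_ge0.
apply: le_trans (expR_taylor1 _) _.
have h : `|b * t + c * t ^+ 2| <= (`|b| + `|c|) * `|t|.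
  apply: le_trans (ler_normD _ _) _; rewrite mulrDl !normrM lerD2l.
  by rewrite ler_wpM2l// ler_piMl.
have bc0 : 0 <= `|b| + `|c| by rewrite addr_ge0.
rewrite [leRHS]mulrAC ler_pM ?sqr_ge0 ?expR_ge0//.
  rewrite -exprMn -[leRHS]real_normK ?num_real// -[leLHS]real_normK ?num_real//.
  by rewrite lerXn2r ?nnegrE// normrM (ger0_norm bc0).
by rewrite ler_expR (le_trans h)// ler_piMr.
Qed.

Context d (T : measurableType d) (P : probability T R).

(** Differentiation under the expectation at [t = 0]: for [|t| <= 1] the Taylor remainder of
    [e^(t Y)] is at most [t^2 Y^2 e^|Y|], which is integrable against [|X|]. *)
Lemma jet_Ex (X Y : T -> R) : tame P X -> exp_tame P Y ->
  jet (fun t => Ex P (fun x => X x * expR (t * Y x))) (Ex P X) (Ex P (fun x => X x * Y x)).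
Proof.
move=> tX eY; have tY := exp_tame_tame eY; have tE := exp_tame_expR_norm eY.
have tC : tame P (fun x => `|X x| * (Y x ^+ 2 * expR `|Y x|)).
  by apply: tameM; [exact: tame_norm|apply: tameM => //; exact: tameX].
exists (Ex P (fun x => `|X x| * (Y x ^+ 2 * expR `|Y x|))) => t t1.
have t1X : tame P (fun x => X x * expR (t * Y x)).
  by apply: tameM => //; apply: exp_tame_expR; exact: exp_tameZ.
have tXY : tame P (fun x => X x * Y x) by exact: tameM.
have tR : tame P (fun x => X x * (expR (t * Y x) - 1 - t * Y x)).
  apply: tameM => //; apply: tameB; last exact: tameZ.
  apply: tameB; last exact: tame_cst.
  by apply: exp_tame_expR; exact: exp_tameZ.
have -> : Ex P (fun x => X x * expR (t * Y x)) - Ex P X - Ex P (fun x => X x * Y x) * t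
   = Ex P (fun x => X x * (expR (t * Y x) - 1 - t * Y x)).
  rewrite mulrC -ExZ; last exact: tame_Int.
  rewrite -ExB; [|exact: tame_Int..].
  rewrite -ExB; [|apply: tame_Int..]; [|exact: tameB|exact: tameZ].
  by congr (Ex P _); apply/funext => x; ring.
apply: le_trans (norm_Ex _) _; first exact: tame_Int.
rewrite mulrC -ExZ; last exact: tame_Int.
apply: Ex_le => [||x].
- by apply: tame_Int; exact: tame_norm.
- by apply: tame_Int; exact: tameZ.
rewrite normrM mulrCA ler_wpM2l// (le_trans (expR_taylor1 _))//.
rewrite exprMn -mulrA ler_wpM2l ?sqr_ge0// ler_wpM2l ?sqr_ge0//.
by rewrite ler_expR normrM ler_piMl.
Qed.

End jet.

(** * Gaussian integration by parts *)

Section gaussian_law.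
Context (R : realType).
Implicit Types m s t : R.
Local Notation mu := (@lebesgue_measure R).

(** The density [normal_pdf] agrees almost everywhere with the Radon-Nikodym derivative, both having
    the same integral over every measurable set. *)
Lemma ge0_integral_normal_prob m s (f : R -> \bar R) :
  measurable_fun [set: R] f -> (forall x, 0 <= f x)%E ->
  (\int[normal_prob m s]_x f x = \int[mu]_x (f x * (normal_pdf m s x)%:E))%E.
Proof.
move=> mf f0; have dom := normal_prob_dominates m s.
rewrite -(Radon_Nikodym_SigmaFinite.change_of_variables dom f0 measurableT mf).
have mpdf : measurable_fun [set: R] (EFin \o normal_pdf m s).
  by apply/measurable_EFinP; exact: measurable_normal_pdf.
have iRN := Radon_Nikodym_SigmaFinite.f_integrable dom.
apply: ae_eq_integral => //.
- by apply: emeasurable_funM => //; exact: measurable_int iRN.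
- exact: emeasurable_funM.
- apply: ae_eqe_mul2l; apply: integral_ae_eq => //.
  by move=> A _ mA; rewrite -(Radon_Nikodym_SigmaFinite.f_integral dom).
Qed.

Lemma normal_prob_mgf m s t : s != 0 ->
  (\int[normal_prob m s]_x (expR (t * x))%:E = (expR (t * m + t ^+ 2 * s ^+ 2 / 2))%:E)%E.
Proof.
move=> s0; rewrite ge0_integral_normal_prob//; last first.
  apply/measurable_EFinP; apply: (measurableT_comp (@measurable_expR R)).
  exact: mulrl_measurable.
pose c := expR (t * m + t ^+ 2 * s ^+ 2 / 2).
(* Completing the square. *)
transitivity (\int[mu]_x (c%:E * (normal_pdf (m + t * s ^+ 2) s x)%:E))%E.
  apply: eq_integral => x _; rewrite -!EFinM; congr EFin.
  rewrite !normal_pdfE// mulrCA [RHS]mulrCA; congr (_ * _).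
  rewrite /normal_fun -!expRD; congr expR.
  by field.
rewrite integralZl//; last exact: integrable_normal_pdf.
by rewrite integral_normal_pdf mule1.
Qed.

Context d (T : measurableType d) (P : probability T R).

(** The integral is transported to the line. The formula also covers the degenerate law, the Dirac
    mass at [m] corresponding to [s = 0]. *)
Lemma gaussian_rv_mgf (X : T -> R) : measurable_fun [set: T] X -> gaussian_rv P X ->
  exists m s, forall t,
    (\int[P]_x (expR (t * X x))%:E = (expR (t * m + t ^+ 2 * s ^+ 2 / 2))%:E)%E.
Proof.
move=> mX [m [s law]]; exists m, s => t.
pose U := measurableTypeR R.
have mXU : measurable_fun [set: T] (X : T -> U) by exact: mX.
have me : measurable_fun [set: U] (fun y : U => (expR (t * (y : R)))%:E).
  apply/measurable_EFinP; apply: (measurableT_comp (@measurable_expR R)).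
  exact: mulrl_measurable.
transitivity (\int[pushforward P (X : T -> U)]_y (expR (t * (y : R)))%:E)%E.
  by rewrite (ge0_integral_pushforward mXU).
have [s0|s0] := eqVneq s 0.
  rewrite (eq_measure_integral (@dirac _ U m R)); last first.
    by move=> A mA _; have := law A mA; rewrite s0 eqxx.
  by rewrite integral_dirac// diracT mul1e s0 expr0n mulr0 mul0r addr0.
rewrite -normal_prob_mgf//; apply: eq_measure_integral => A mA _.
by have := law A mA; rewrite (negbTE s0).
Qed.

Lemma gaussian_rv_exp_tame (X : T -> R) : measurable_fun [set: T] X ->
  gaussian_rv P X -> exp_tame P X.
Proof.
move=> mX gX; split=> // t; apply: ge0_Int => [|x|].
- by apply: (measurableT_comp (@measurable_expR R)); exact: measurable_funM.
- exact: expR_ge0.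
- by have [m [s ->]] := gaussian_rv_mgf mX gX; rewrite ltry.
Qed.

(** The parameters of the law are read off the generating function: its first derivative at [0]
    forces [m = 0], its second one gives [s^2 = E X^2]. *)
Lemma centered_gaussian_rv_mgf (X : T -> R) : measurable_fun [set: T] X ->
  gaussian_rv P X -> Ex P X = 0 -> forall t,
  Ex P (fun x => expR (t * X x)) = expR (t ^+ 2 * Ex P (fun x => X x ^+ 2) / 2).
Proof.
move=> mX gX X0.
have eX := gaussian_rv_exp_tame mX gX; have tX := exp_tame_tame eX.
have [m [s mgf]] := gaussian_rv_mgf mX gX.
have {}mgf t : Ex P (fun x => expR (t * X x)) = expR (t * m + t ^+ 2 * s ^+ 2 / 2).
  by rewrite /Rintegral mgf.
(* The derivative is needed at every [u], so that it can be differentiated once more. *)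
have D1 u : Ex P (fun x => expR (u * X x) * X x)
    = (m + u * s ^+ 2) * expR (u * m + u ^+ 2 * s ^+ 2 / 2).
  have J := jet_Ex (exp_tame_expR (exp_tameZ u eX)) eX.
  have J' := jet_expR_quad (u * m + u ^+ 2 * s ^+ 2 / 2) (m + u * s ^+ 2) (s ^+ 2 / 2).
  have [|//] := jet_uniq J (eq_jet _ J') => t.
  under [RHS]eq_Rintegral do rewrite -expRD -mulrDl.
  by rewrite mgf; congr expR; field.
have m0 : m = 0.
  have := D1 0; rewrite expr0n /= !mul0r !addr0 expR0 mulr1.
  by under eq_Rintegral do rewrite mul0r expR0 mul1r; rewrite X0.
have E2 : Ex P (fun x => X x ^+ 2) = s ^+ 2.
  have J := jet_Ex tX eX.
  have J' := jetZ (s ^+ 2) (jetM_id (jet_expR_quad 0 0 (s ^+ 2 / 2))).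
  have [|_] := jet_uniq J (eq_jet _ J') => [t|].
    under [RHS]eq_Rintegral do rewrite mulrC.
    by rewrite D1 m0 mulr0 !add0r mul0r add0r mulrCA mulrA; congr (_ * expR _); ring.
  by rewrite expR0 mulr1 => <-; apply: eq_Rintegral => x _; rewrite expr2.
by move=> t; rewrite mgf E2 m0 mulr0 add0r.
Qed.

End gaussian_law.

(** * Integration by parts for polynomials in a Gaussian vector *)

Section gaussian_vector.
Context d (T : measurableType d) (R : realType) (P : probability T R).
Context (N : nat) (X : 'I_N -> T -> R).
Hypothesis mX : forall i, measurable_fun [set: T] (X i).
Hypothesis gX : forall a : 'I_N -> R, gaussian_rv P (fun x => \sum_i a i * X i x).
Hypothesis X0 : forall i, Ex P (X i) = 0.
Implicit Types (s a c : 'I_N -> R) (F : T -> R) (D : 'I_N -> T -> R).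

Local Notation G i j := (Ex P (fun x => X i x * X j x)).

Definition lin s : T -> R := fun x => \sum_i s i * X i x.
Definition unit_coef (k : 'I_N) : 'I_N -> R := fun i => (i == k)%:R.

Lemma lin_unit k : lin (unit_coef k) = X k.
Proof.
apply/funext => x; rewrite /lin (bigD1 k)//= /unit_coef eqxx mul1r big1 ?addr0//.
by move=> i /negbTE ->; rewrite mul0r.
Qed.

Lemma lin_shift s k (t : R) x :
  lin (fun i => s i + t * unit_coef k i) x = lin s x + t * X k x.
Proof.
rewrite -(lin_unit k) /lin mulr_sumr -big_split/=.
by apply: eq_bigr => i _; ring.
Qed.

Lemma measurable_lin s : measurable_fun [set: T] (lin s).
Proof. by apply: measurable_sum => i; exact: measurable_funM. Qed.

Lemma exp_tame_lin s : exp_tame P (lin s).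
Proof. by apply: gaussian_rv_exp_tame; [exact: measurable_lin|exact: gX]. Qed.

Lemma tame_lin s : tame P (lin s).
Proof. exact/exp_tame_tame/exp_tame_lin. Qed.

Lemma exp_tame_X i : exp_tame P (X i).
Proof. by rewrite -lin_unit; exact: exp_tame_lin. Qed.

Lemma tame_X i : tame P (X i).
Proof. exact/exp_tame_tame/exp_tame_X. Qed.

Lemma Ex_lin s : Ex P (lin s) = 0.
Proof.
rewrite Ex_sum => [|i]; last by apply/tame_Int/tameZ/tame_X.
by rewrite big1// => i _; rewrite ExZ ?X0 ?mulr0//; exact/tame_Int/tame_X.
Qed.

Lemma Ex_sqr_lin_shift s k (t : R) :
  Ex P (fun x => lin (fun i => s i + t * unit_coef k i) x ^+ 2) =
  Ex P (fun x => lin s x ^+ 2) + 2 * (\sum_j s j * G k j) * t + G k k * t ^+ 2.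
Proof.
under eq_Rintegral do rewrite lin_shift.
have tXL : tame P (fun x => X k x * lin s x) by apply: tameM; [exact: tame_X|exact: tame_lin].
have t2 : tame P (fun x => lin s x ^+ 2) by exact/tameX/tame_lin.
have tXX : tame P (fun x => X k x * X k x) by apply: tameM; exact: tame_X.
have -> : \sum_j s j * G k j = Ex P (fun x => X k x * lin s x).
  have tj j : tame P (fun x => X k x * X j x) by apply: tameM; exact: tame_X.
  transitivity (\sum_j Ex P (fun x => s j * (X k x * X j x))).
    by apply: eq_bigr => j _; rewrite ExZ//; exact: tame_Int.
  rewrite -Ex_sum => [|j]; last by apply/tame_Int/tameZ.
  apply: eq_Rintegral => x _; rewrite /lin mulr_sumr.
  by apply: eq_bigr => j _; rewrite mulrCA.
rewrite mulrAC (mulrC (G k k)) -!ExZ; [|exact: tame_Int..].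
have tZ := tameZ (2 * t) tXL; have tD := tameD t2 tZ.
rewrite -(ExD (tame_Int t2) (tame_Int tZ)).
rewrite -(ExD (tame_Int tD) (tame_Int (tameZ (t ^+ 2) tXX))).
by apply: eq_Rintegral => x _; ring.
Qed.

Lemma lin_mgf s : Ex P (fun x => expR (lin s x)) = expR (Ex P (fun x => lin s x ^+ 2) / 2).
Proof.
have := centered_gaussian_rv_mgf (measurable_lin s) (gX s) (Ex_lin s) 1.
by under eq_Rintegral do rewrite mul1r; rewrite expr1n mul1r.
Qed.

(* D i is the derivative of F in the direction of the i-th variable; the
   exponential weight is what makes the property stable under multiplication
   by a variable, as E[X_k F e^(s.X)] is the derivative of E[F e^(s.X)]. *)
Definition stein F D : Prop :=
  [/\ tame P F, forall i, tame P (D i) & forall s i,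
    Ex P (fun x => X i x * F x * expR (lin s x)) =
    Ex P (fun x => D i x * expR (lin s x)) +
    (\sum_j s j * G i j) * Ex P (fun x => F x * expR (lin s x))].

Lemma eq_stein F F' D D' : stein F D -> F =1 F' -> D =2 D' -> stein F' D'.
Proof.
move=> FD /funext <- DD'.
by have <- : D = D' by apply/funext => i; apply/funext => x; exact: DD'.
Qed.

(** The identity [E e^(s.X) = exp (E[(s.X)^2] / 2)] is differentiated in the [i]-th coefficient: on
    the left under the expectation, on the right as the exponential of a quadratic in [t]. *)
Lemma stein1 : stein (fun=> 1) (fun _ _ => 0).
Proof.
split=> [|i|s i]; [exact: tame_cst..|].
have -> : Ex P (fun x => 0 * expR (lin s x)) = 0.
  by under eq_Rintegral do rewrite mul0r; rewrite Ex_cst.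
under eq_Rintegral do rewrite mulr1 mulrC.
under [in RHS]eq_Rintegral do rewrite mul1r.
have J := jet_Ex (exp_tame_expR (exp_tame_lin s)) (exp_tame_X i).
have J' := jet_expR_quad (Ex P (fun x => lin s x ^+ 2) / 2)
  (\sum_j s j * G i j) (G i i / 2).
rewrite add0r; have [|_ ->] := jet_uniq J (eq_jet _ J') => [t|]; last by rewrite lin_mgf.
under [RHS]eq_Rintegral do rewrite -expRD -lin_shift.
by rewrite lin_mgf Ex_sqr_lin_shift; congr expR; field.
Qed.

(** The identity for [F] is differentiated in the [k]-th coefficient. The factor
    [\sum_j s j * G i j] contributes the extra [G i k], so [D i] is the gradient weighted by the
    covariances rather than a bare partial derivative. *)
Lemma steinX k F D : stein F D ->
  stein (fun x => X k x * F x) (fun i x => X k x * D i x + G i k * F x).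
Proof.
move=> [tF tD FD]; have tX := tame_X; have te s := exp_tame_expR (exp_tame_lin s).
split=> [|i|s i]; first exact: tameM.
  by apply: tameD; [exact: tameM|exact: tameZ].
have J1 : jet _ _ _ := jet_Ex (tameM (tameM (tX i) tF) (te s)) (exp_tame_X k).
have J2 : jet _ _ _ := jet_Ex (tameM (tD i) (te s)) (exp_tame_X k).
have J3 : jet _ _ _ := jet_Ex (tameM tF (te s)) (exp_tame_X k).
have J4 := jetD (jetD J2 (jetZ (\sum_j s j * G i j) J3)) (jetZ (G i k) (jetM_id J3)).
have [t|_] := jet_uniq J1 (eq_jet _ J4).
  have E f : Ex P (fun x => f x * expR (lin s x) * expR (t * X k x)) =
     Ex P (fun x => f x * expR (lin (fun j => s j + t * unit_coef k j) x)).
    by apply: eq_Rintegral => x _; rewrite lin_shift expRD mulrA.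
  rewrite !E FD -addrA; congr (_ + _); rewrite mulrA -mulrDl; congr (_ * _).
  under [RHS]eq_bigr do rewrite mulrDl.
  rewrite big_split/=; congr (_ + _).
  rewrite (bigD1 k)//= big1 ?addr0 => [|j /negbTE jk]; last first.
    by rewrite /unit_coef jk mulr0 mul0r.
  by rewrite /unit_coef eqxx mulr1 mulrC.
move=> E; transitivity (Ex P (fun x => X i x * F x * expR (lin s x) * X k x)).
  by apply: eq_Rintegral => x _; ring.
rewrite {}E.
have E1 : Ex P (fun x => F x * expR (lin s x) * X k x) =
    Ex P (fun x => X k x * F x * expR (lin s x)).
  by apply: eq_Rintegral => x _; ring.
rewrite E1 addrAC; congr (_ + _).
rewrite -ExZ; last by apply/tame_Int/tameM.
rewrite -ExD; last 2 first.
- by apply/tame_Int/tameM; [exact: tameM|].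
- by apply/tame_Int/tameZ/tameM.
by apply: eq_Rintegral => x _; ring.
Qed.

Lemma steinD F F' D D' : stein F D -> stein F' D' ->
  stein (fun x => F x + F' x) (fun i x => D i x + D' i x).
Proof.
move=> [tF tD FD] [tF' tD' FD']; have tX := tame_X.
have te s := exp_tame_expR (exp_tame_lin s).
split=> [|i|s i]; [exact: tameD..|].
transitivity (Ex P (fun x => X i x * F x * expR (lin s x)) +
   Ex P (fun x => X i x * F' x * expR (lin s x))).
  rewrite -ExD; first by apply: eq_Rintegral => x _; ring.
  - by apply: tame_Int; do 2 apply: tameM => //.
  - by apply: tame_Int; do 2 apply: tameM => //.
rewrite FD FD' addrACA -mulrDr -!ExD; [|apply/tame_Int; exact: tameM..].
by congr (_ + _ * _); apply: eq_Rintegral => x _; ring.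
Qed.

Lemma steinZ (a : R) F D : stein F D ->
  stein (fun x => a * F x) (fun i x => a * D i x).
Proof.
move=> [tF tD FD]; have tX := tame_X; have te s := exp_tame_expR (exp_tame_lin s).
split=> [|i|s i]; [exact: tameZ..|].
transitivity (a * Ex P (fun x => X i x * F x * expR (lin s x))).
  rewrite -ExZ; first by apply: eq_Rintegral => x _; ring.
  by apply: tame_Int; do 2 apply: tameM => //.
rewrite FD mulrDr mulrCA -!ExZ; [|by apply/tame_Int; do ?[apply: tameZ|apply: tameM]..].
by congr (_ + _); apply: eq_Rintegral => x _; ring.
Qed.

Lemma stein_sum (r : seq 'I_N) (F : 'I_N -> T -> R) (D : 'I_N -> 'I_N -> T -> R) :
  (forall j, stein (F j) (D j)) ->
  stein (fun x => \sum_(j <- r) F j x) (fun i x => \sum_(j <- r) D j i x).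
Proof.
move=> FD; elim: r => [|j r IH].
  by apply: (eq_stein (steinZ 0 stein1)) => [x|i x]; rewrite big_nil mul0r.
by apply: (eq_stein (steinD (FD j) IH)) => [x|i x]; rewrite big_cons.
Qed.

(** At [s = 0] the exponential weight is [1] and the covariance term vanishes. *)
Lemma stein_Ex F D i : stein F D -> Ex P (fun x => X i x * F x) = Ex P (D i).
Proof.
move=> [_ _ /(_ (fun=> 0) i)].
have -> : \sum_j 0 * G i j = 0 by rewrite big1// => j _; rewrite mul0r.
have L0 x : lin (fun=> 0) x = 0 by rewrite /lin big1// => j _; rewrite mul0r.
rewrite mul0r addr0.
under eq_Rintegral do rewrite L0 expR0 mulr1.
by under [X in _ = X -> _]eq_Rintegral do rewrite L0 expR0 mulr1.
Qed.

Lemma stein_lin c F D : stein F D ->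
  stein (fun x => lin c x * F x) (fun i x => lin c x * D i x + (\sum_j c j * G i j) * F x).
Proof.
move=> FD; apply: eq_stein (stein_sum _ (fun j => steinZ (c j) (steinX j FD))) _ _.
  by move=> x; rewrite /lin mulr_suml; apply: eq_bigr => j _; rewrite mulrA.
move=> i x; rewrite /lin !mulr_suml -big_split/=.
by apply: eq_bigr => j _; ring.
Qed.

(** The power rule. At [n = 0] the truncated exponent [n.-1] is harmless, its coefficient being
    zero. *)
Lemma stein_lin_exp c n : stein (fun x => lin c x ^+ n)
  (fun i x => n%:R * (\sum_j c j * G i j) * lin c x ^+ n.-1).
Proof.
elim: n => [|n IH].
  by apply: (eq_stein stein1) => [x|i x]; rewrite ?expr0// !mul0r.
apply: (eq_stein (stein_lin c IH)) => [x|i x]; first by rewrite exprS.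
case: n {IH} => [|n] /=; first by rewrite expr0; ring.
by rewrite exprS -[n.+2]addn1 natrD; ring.
Qed.

Lemma stein_Ex_lin c F D : stein F D ->
  Ex P (fun x => lin c x * F x) = \sum_i c i * Ex P (D i).
Proof.
move=> FD; have [tF tD _] := FD.
transitivity (\sum_i c i * Ex P (fun x => X i x * F x)); last first.
  by apply: eq_bigr => i _; rewrite (stein_Ex _ FD).
transitivity (\sum_i Ex P (fun x => c i * (X i x * F x))); last first.
  by apply: eq_bigr => i _; rewrite ExZ//; apply/tame_Int/tameM => //; exact: tame_X.
rewrite -Ex_sum => [|i]; last by apply/tame_Int/tameZ/tameM => //; exact: tame_X.
apply: eq_Rintegral => x _; rewrite /lin mulr_suml.
by apply: eq_bigr => i _; rewrite mulrA.
Qed.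

(** Integration by parts on one factor; the case of exponent [2] identifies
    [\sum_i c i * \sum_j c j * G i j] with the variance. *)
Lemma Ex_lin_exp c n : Ex P (fun x => lin c x ^+ n.+2) =
  n.+1%:R * Ex P (fun x => lin c x ^+ 2) * Ex P (fun x => lin c x ^+ n).
Proof.
have E m : Ex P (fun x => lin c x ^+ m.+2) =
    m.+1%:R * (\sum_i c i * \sum_j c j * G i j) * Ex P (fun x => lin c x ^+ m).
  under eq_Rintegral do rewrite exprS.
  rewrite (stein_Ex_lin c (stein_lin_exp c m.+1)) /= mulr_sumr mulr_suml.
  apply: eq_bigr => i _; rewrite ExZ; last exact/tame_Int/tameX/tame_lin.
  by ring.
rewrite E (E 0%N); under [X in _ = _ * (_ * X) * _]eq_Rintegral do rewrite expr0.
by rewrite Ex_cst; ring.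
Qed.

Section second_chaos.
Variable a : 'I_N -> R.
Hypothesis X1 : forall i, G i i = 1.

(** A combination of second Hermite polynomials of the [X i], whose normalisation [1 / sqrt 2] is
    left to the coefficients. *)
Definition chaos2 : T -> R := fun x => \sum_i a i * (X i x ^+ 2 - 1).

Lemma tame_chaos2 : tame P chaos2.
Proof.
apply: tame_sum => i; apply: tameZ; apply: tameB; last exact: tame_cst.
exact/tameX/tame_X.
Qed.

(** Induction through [q^(n+1) = sum_j a_j (X_j X_j - 1) q^n] with [q = chaos2], whose derivative in
    direction [i] is [2 sum_j a_j G i j X_j]. *)
Lemma stein_chaos2_exp n : stein (fun x => chaos2 x ^+ n)
  (fun i x => n%:R * (2 * lin (fun j => a j * G i j) x) * chaos2 x ^+ n.-1).
Proof.
elim: n => [|n IH].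
  by apply: (eq_stein stein1) => [x|i x]; rewrite ?expr0// !mul0r.
apply: eq_stein
  (stein_sum _ (fun j => steinZ (a j) (steinD (steinX j (steinX j IH)) (steinZ (-1) IH)))) _ _.
  move=> x; rewrite exprS {2}/chaos2 mulr_suml.
  by apply: eq_bigr => j _; ring.
move=> i x /=; rewrite /lin.
transitivity (chaos2 x * (n%:R * (2 * lin (fun j => a j * G i j) x) * chaos2 x ^+ n.-1) +
   2 * lin (fun j => a j * G i j) x * chaos2 x ^+ n).
  rewrite {1}/chaos2 mulr_suml.
  rewrite [X in _ = _ + 2 * X * _]/lin mulr_sumr mulr_suml -big_split/=.
  by apply: eq_bigr => j _; ring.
case: n {IH} => [|n] /=; first by rewrite expr0 /lin; ring.
by rewrite /lin exprS -[n.+2]addn1 natrD; ring.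
Qed.

(** One factor is expanded as [sum_i a_i (X_i^2 - 1)] and one [X_i] is integrated by parts. As
    [G i i = 1], the derivative of the other [X_i] cancels the [-1], and the derivative of [q^(n+1)]
    remains. *)
Lemma Ex_chaos2_exp n : Ex P (fun x => chaos2 x ^+ n.+2) =
  2 * n.+1%:R * Ex P (fun x => chaos2 x ^+ n *
    (\sum_i \sum_j a i * a j * G i j * X i x * X j x)).
Proof.
have tX := tame_X; have tc m := tameX m tame_chaos2; have tl := tame_lin.
transitivity (\sum_i a i * (Ex P (fun x => X i x * (X i x * chaos2 x ^+ n.+1))
   - Ex P (fun x => chaos2 x ^+ n.+1))).
  under eq_Rintegral do rewrite exprS {1}/chaos2 mulr_suml.
  rewrite Ex_sum => [|i]; last first.
    apply: tame_Int; apply: tameM => //; apply/tameZ/tameB; first exact: tameX.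
    exact: tame_cst.
  apply: eq_bigr => i _; rewrite -ExB; last 2 first.
  - by apply: tame_Int; do 2 apply: tameM => //.
  - exact: tame_Int.
  rewrite -ExZ; last by apply/tame_Int/tameB => //; do 2 apply: tameM => //.
  by apply: eq_Rintegral => x _; ring.
transitivity (\sum_i a i * Ex P (fun x => X i x *
    (n.+1%:R * (2 * lin (fun j => a j * G i j) x) * chaos2 x ^+ n))).
  apply: eq_bigr => i _; congr (_ * _).
  rewrite (stein_Ex _ (steinX i (stein_chaos2_exp n.+1))) X1 -ExB; last 2 first.
  - apply/tame_Int/tameD; last exact: tameZ.
    by apply: tameM => //; apply: tameM => //; do 2 apply: tameZ => //.
  - exact: tame_Int.
  by apply: eq_Rintegral => x _ /=; ring.
have ti i : tame P (fun x => X i x * (n.+1%:R * (2 * lin (fun j => a j * G i j) x) * chaos2 x ^+ n)).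
  by apply: tameM => //; apply: tameM => //; do 2 apply: tameZ => //.
rewrite -ExZ; last first.
  apply/tame_Int/tameM => //; apply: tame_sum => i; apply: tame_sum => j.
  by do 2 apply: tameM => //; exact: tame_cst.
transitivity (\sum_i Ex P (fun x => a i * (X i x *
    (n.+1%:R * (2 * lin (fun j => a j * G i j) x) * chaos2 x ^+ n)))).
  by apply: eq_bigr => i _; rewrite ExZ//; exact: tame_Int.
rewrite -Ex_sum => [|i]; last exact/tame_Int/tameZ.
apply: eq_Rintegral => x _; rewrite !mulr_sumr; apply: eq_bigr => i _.
rewrite /lin !(mulr_sumr, mulr_suml); apply: eq_bigr => j _.
by ring.
Qed.

End second_chaos.
End gaussian_vector.

(** * Moments of the second Gaussian chaos *)

Section exponential_moments.
Context (R : realType).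

(** The induction hypothesis times [w], added to [(p + 1) u^p (w - u)^2 >= 0], is the next case. *)
Lemma weighted_AGM (u w : R) (p : nat) : 0 <= u -> 0 <= w ->
  p.+1%:R * u ^+ p * w <= p%:R * u ^+ p.+1 + w ^+ p.+1.
Proof.
move=> u0 w0; elim: p => [|p IH]; first by rewrite !expr0 !expr1 mul0r add0r !mul1r.
have h : 0 <= p.+1%:R * (u ^+ p * (w - u) ^+ 2).
  by rewrite mulr_ge0// mulr_ge0 ?sqr_ge0 ?exprn_ge0.
have := ler_wpM2r w0 IH.
rewrite !exprS -[p.+2%:R]natr1 -[p.+1%:R]natr1 in h *.
by move: (u ^+ p) (w ^+ p) (p%:R : R) h => U W r; nra.
Qed.

Lemma expR_coeff_le (x : R) n : 0 <= x -> x ^+ n / n`!%:R <= expR x.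
Proof.
move=> x0; have nd : nondecreasing_seq (series (exp_coeff x)).
  by apply/nondecreasing_series => k _ _; exact: exp_coeff_ge0.
apply: le_trans (nondecreasing_cvgn_le nd (is_cvg_series_exp_coeff x) n.+1).
by rewrite /series /= big_nat_recr//= lerDr sumr_ge0// => k _; exact: exp_coeff_ge0.
Qed.

Lemma expn_fact_le n : n%:R ^+ n / n`!%:R <= expR 1 ^+ n :> R.
Proof. by apply: le_trans (expR_coeff_le _ _) _; rewrite // -expRM_natl mulr1. Qed.

(** In the exponential series of [x] and [- x], both cut at [2 n] terms, the odd powers cancel. *)
Lemma cosh_series_cvg (x : R) :
  (fun n => 2 * \sum_(k < n) x ^+ (k * 2) / (k * 2)`!%:R) @ \oo --> expR x + expR (- x).
Proof.
have h (z : R) : (fun n => series (exp_coeff z) (n * 2)%N) @ \oo --> expR z.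
  apply: (cvg_comp (fun n => n * 2)%N (series (exp_coeff z))); first exact: cvg_mulnr.
  exact: is_cvg_series_exp_coeff.
rewrite [X in X @ _ --> _](_ : _ = fun n => series (exp_coeff x) (n * 2)%N +
  series (exp_coeff (- x)) (n * 2)%N); first exact: cvgD.
apply/funext => n; rewrite /series /=; elim: n => [|n IH].
  by rewrite !big_geq// big_ord0 mulr0 addr0.
rewrite mulSn !addSn add0n !big_nat_recr//= big_ord_recr/= mulrDr IH /exp_coeff /=.
have E m : (- x) ^+ (m * 2) = x ^+ (m * 2) by rewrite mulnC !exprM sqrrN.
rewrite !exprS E; ring.
Qed.

Lemma geometric_sum_le (y : R) n : 0 <= y -> y <= 2^-1 ->
  \sum_(k < n) y ^+ k.+1 <= 2 * y.
Proof.
move=> y0 y1; elim: n => [|n IH]; first by rewrite big_ord0 mulr_ge0.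
rewrite big_ord_recl expr1; under eq_bigr do rewrite /bump /= exprS.
rewrite -mulr_sumr; nra.
Qed.

Context d (T : measurableType d) (P : probability T R).

(* The constants come from [n^n / n! <= e^n]. *)
Lemma mgf_le_of_even_moments (q : T -> R) (nu t : R) : tame P q -> Ex P q = 0 ->
  0 <= nu -> (forall m, Ex P (fun x => q x ^+ (m.+1 * 2)) <= (2 * m.+1%:R * nu) ^+ (m.+1 * 2)) ->
  0 <= t -> t * nu <= (2 * expR 1)^-1 ->
  Int P (fun x => expR (t * q x)) /\
  Ex P (fun x => expR (t * q x)) <= expR (4 * expR 1 ^+ 2 * t ^+ 2 * nu ^+ 2).
Proof.
move=> tq q0 nu0 mom t0 tnu; have mq := tame_measurable tq.
pose e : R := expR 1; have e0 : 0 < e by exact: expR_gt0.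
(* For [m = 2 k], the moment bound and [m^m / m! <= e^m] bound the [k]-th even term of the series by
   [(e t nu)^(2k) = y^k]. *)
pose y := (e * (t * nu)) ^+ 2.
have y0 : 0 <= y by exact: sqr_ge0.
have y1 : y <= 2^-1.
  have : e * (t * nu) <= 2^-1.
    have -> : 2^-1 = e * (2 * e)^-1 by field; rewrite gt_eqF.
    exact: ler_wpM2l (ltW e0) _ _ tnu.
  have : 0 <= e * (t * nu) by rewrite !mulr_ge0// ltW.
  by rewrite /y; nra.
pose g n x := 2 * \sum_(k < n) (t * q x) ^+ (k * 2) / (k * 2)`!%:R.
have term0 k x : 0 <= (t * q x) ^+ (k * 2) / (k * 2)`!%:R.
  by rewrite divr_ge0// exprM sqr_ge0.
have g0 n x : 0 <= g n x by rewrite mulr_ge0// sumr_ge0.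
have tg n : tame P (g n).
  apply: tameZ; apply: tame_sum => k; apply: tameM; last exact: tame_cst.
  by apply: tameX; exact: tameZ.
have mcosh : measurable_fun [set: T] (fun x => expR (t * q x) + expR (- (t * q x))).
  have mt : measurable_fun [set: T] (fun x => t * q x) by exact: measurable_funM.
  apply: measurable_funD; apply: (measurableT_comp (@measurable_expR R)) => //.
  exact: measurableT_comp.
(* Only even powers occur, so the partial sums increase and monotone convergence applies; the
   assumed moment bounds are those of even order. *)
have cosh_le : (\int[P]_x (expR (t * q x) + expR (- (t * q x)))%:E <= (2 * (1 + 2 * y))%:E)%E.
  rewrite (eq_integral (fun x => limn (fun n => (g n x)%:E))%E); last first.
    move=> x _; apply/esym/cvg_lim => //; apply: cvg_EFin; first exact: nearW.
    exact: cosh_series_cvg.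
  rewrite monotone_convergence//; last 3 first.
  - by move=> n; apply/measurable_EFinP/tame_measurable.
  - by move=> n x _; rewrite lee_fin.
  - move=> x _ m n mn; rewrite lee_fin ler_wpM2l//.
    by rewrite -(subnKC mn) big_split_ord/= lerDl sumr_ge0.
  apply: lime_le.
    apply: ereal_nondecreasing_is_cvgn => m n mn; apply: ge0_le_integral => //.
    - by move=> x _; rewrite lee_fin.
    - by apply/measurable_EFinP/tame_measurable.
    - by apply/measurable_EFinP/tame_measurable.
    - move=> x _; rewrite lee_fin ler_wpM2l//.
      by rewrite -(subnKC mn) big_split_ord/= lerDl sumr_ge0.
  apply: nearW => n; rewrite -ExE; last exact: tame_Int.
  rewrite lee_fin /g ExZ; last first.
    apply/tame_Int/tame_sum => k; apply: tameM; last exact: tame_cst.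
    by apply: tameX; exact: tameZ.
  rewrite ler_wpM2l// Ex_sum => [|k]; last first.
    apply/tame_Int; apply: tameM; last exact: tame_cst.
    by apply: tameX; exact: tameZ.
  case: n => [|n]; first by rewrite big_ord0 addr_ge0// mulr_ge0.
  rewrite big_ord_recl lerD//.
    by under eq_Rintegral do rewrite expr0 fact0 divr1; rewrite Ex_cst.
  apply: le_trans (geometric_sum_le n y0 y1); apply: ler_sum => k _.
  rewrite lift0 /=; set m := (k.+1 * 2)%N.
  have -> : Ex P (fun x => (t * q x) ^+ m / m`!%:R) = t ^+ m / m`!%:R * Ex P (fun x => q x ^+ m).
    rewrite -ExZ; last exact/tame_Int/tameX.
    by apply: eq_Rintegral => x _; rewrite exprMn mulrAC.
  apply: (@le_trans _ _ (t ^+ m / m`!%:R * (2 * k.+1%:R * nu) ^+ m)).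
    by apply: ler_wpM2l; [rewrite divr_ge0// exprn_ge0 // | exact: mom].
  rewrite -natrM (_ : (2 * k.+1)%N = m); last by rewrite mulnC.
  have -> : t ^+ m / m`!%:R * (m%:R * nu) ^+ m = (m%:R ^+ m / m`!%:R) * (t * nu) ^+ m.
    by rewrite !exprMn; ring.
  have -> : y ^+ k.+1 = e ^+ m * (t * nu) ^+ m by rewrite /y -exprM mulnC exprMn.
  rewrite ler_wpM2r ?exprn_ge0 ?mulr_ge0//.
  exact: expn_fact_le.
have Icosh : Int P (fun x => expR (t * q x) + expR (- (t * q x))).
  apply: ge0_Int => //.
  by apply: le_lt_trans cosh_le _; rewrite ltry.
have Iexp : Int P (fun x => expR (t * q x)).
  apply: (Int_le _ Icosh) => [|x].
    by apply: (measurableT_comp (@measurable_expR R)); exact: measurable_funM.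
  by rewrite ger0_norm ?expR_ge0// lerDl expR_ge0.
split=> //.
have Itq : Int P (fun x => t * q x) by exact/tame_Int/tameZ.
(* With [u = t q], of mean zero, [e^(-u) >= 1 - u] removes the constant in excess:
   [2 (1 + 2 y) - 1 = 1 + 4 y <= e^(4 y)]. *)
apply: (@le_trans _ _ (Ex P (fun x => (expR (t * q x) + expR (- (t * q x))) + (t * q x - 1)))).
  apply: Ex_le => // [|x]; first by apply: IntD => //; apply: IntB => //; exact: Int_cst.
  by have := expR_ge1Dx (- (t * q x)); lra.
rewrite ExD//; last by apply: IntB => //; exact: Int_cst.
rewrite ExB//; last exact: Int_cst.
rewrite ExZ; last exact: tame_Int.
rewrite Ex_cst q0 mulr0 sub0r.
apply: (@le_trans _ _ (1 + 4 * y)).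
  by move: cosh_le; rewrite -ExE// lee_fin; lra.
apply: le_trans (expR_ge1Dx _) _; rewrite ler_expR /y -/e !exprMn; lra.
Qed.

End exponential_moments.

Section chaos2_moments.
Context d (T : measurableType d) (R : realType) (P : probability T R).
Context (N : nat) (X : 'I_N -> T -> R).
Hypothesis mX : forall i, measurable_fun [set: T] (X i).
Hypothesis gX : forall a : 'I_N -> R, gaussian_rv P (fun x => \sum_i a i * X i x).
Hypothesis X0 : forall i, Ex P (X i) = 0.
Local Notation G i j := (Ex P (fun x => X i x * X j x)).

(** Iteration of [Ex_lin_exp], with [2 m + 1 <= 2 (m + 1)]. *)
Lemma Ex_lin_even_le c m :
  Ex P (fun x => lin X c x ^+ (m * 2)) <= (2 * m%:R * Ex P (fun x => lin X c x ^+ 2)) ^+ m.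
Proof.
have v0 : 0 <= Ex P (fun x => lin X c x ^+ 2) by apply: Ex_ge0 => x; exact: sqr_ge0.
elim: m => [|m IH]; first by under eq_Rintegral do rewrite expr0; rewrite Ex_cst expr0.
rewrite mulSn (Ex_lin_exp mX gX X0 c (m * 2)).
move: (Ex P (fun x => lin X c x ^+ 2)) v0 IH => v v0 IH.
rewrite exprS ler_pM//.
- by rewrite mulr_ge0.
- by apply: Ex_ge0 => x; rewrite exprM sqr_ge0.
- by rewrite ler_wpM2r// -natrM ler_nat; lia.
- apply: le_trans IH _; apply: lerXn2r; rewrite ?nnegrE ?mulr_ge0//.
  by rewrite ler_wpM2r// ler_wpM2l// ler_nat.
Qed.

Variable a : 'I_N -> R.
Hypothesis X1 : forall i, G i i = 1.
Context (M : nat) (b : 'I_N -> 'I_M -> R).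
Hypothesis Gb : forall i j, G i j = \sum_k b i k * b j k.
Local Notation q := (chaos2 X a).
Let Y (k : 'I_M) := lin X (fun i => a i * b i k).
Let v (k : 'I_M) := Ex P (fun x => Y k x ^+ 2).

Let v_ge0 k : 0 <= v k.
Proof. by apply: Ex_ge0 => x; exact: sqr_ge0. Qed.

Let tq : tame P q. Proof. exact: tame_chaos2. Qed.
Let tY k : tame P (Y k). Proof. exact: tame_lin. Qed.

(** The Gram factor [b] turns the form [sum_ij a_i a_j G i j X_i X_j] into the sum of squares
    [sum_k Y_k^2]. *)
Let Ex_q_exp n : Ex P (fun x => q x ^+ n.+2) =
  2 * n.+1%:R * \sum_k Ex P (fun x => q x ^+ n * Y k x ^+ 2).
Proof.
rewrite (Ex_chaos2_exp mX gX X0 _ X1) -Ex_sum => [|k]; last first.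
  by apply/tame_Int/tameM; exact: tameX.
congr (_ * _); apply: eq_Rintegral => x _; rewrite -mulr_sumr; congr (_ * _).
under eq_bigr do under eq_bigr do rewrite Gb mulr_sumr !mulr_suml.
under eq_bigr do rewrite exchange_big/=.
rewrite exchange_big/=; apply: eq_bigr => k _.
rewrite expr2 {1}/Y /lin mulr_suml; apply: eq_bigr => i _.
by rewrite mulr_sumr; apply: eq_bigr => j _; ring.
Qed.

Let Ex_q_sqr : Ex P (fun x => q x ^+ 2) = 2 * \sum_k v k.
Proof.
rewrite Ex_q_exp mulr1; congr (_ * _); apply: eq_bigr => k _.
by apply: eq_Rintegral => x _; rewrite expr0 mul1r.
Qed.

(* Weighted AM-GM applied to [be q^2] and [al Y_k^2] with
   [be = 2 (m+1) E Y_k^2], for which [E Y_k^(2m+2) <= be^(m+1)]. *)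
Let Ex_q_Y_le (m : nat) (al : R) k : 0 < al ->
  m.+1%:R * al * Ex P (fun x => q x ^+ (m * 2) * Y k x ^+ 2) <=
  2 * m.+1%:R * v k * (m%:R * Ex P (fun x => q x ^+ (m.+1 * 2)) + al ^+ m.+1).
Proof.
(* The weight [be] degenerates when [v k = 0]; then [E Y_k^4 = 0], and Cauchy-Schwarz makes the left
   side nonpositive. *)
move=> al0; have [vk|vk] := eqVneq (v k) 0.
  rewrite vk mulr0 mul0r pmulr_rle0 ?mulr_gt0//.
  apply: le_trans (ler_norm _) _.
  apply: le_trans (cauchy_schwarz (tame_Lfun2 (tameX (m * 2) tq)) (tame_Lfun2 (tameX 2 (tY k)))) _.
  rewrite [X in _ * X](_ : _ = 0) ?mulr0// /norm2.
  under eq_Rintegral do rewrite -exprM.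
  by rewrite (Ex_lin_exp mX gX X0) -/(Y k) -/(v k) vk mulr0 sqrtr0.
have {}vk : 0 < v k by rewrite lt_neqAle eq_sym vk v_ge0.
pose be := 2 * m.+1%:R * v k; have be0 : 0 < be by rewrite !mulr_gt0.
have h : Ex P (fun x => m.+1%:R * be ^+ m * al * (q x ^+ (m * 2) * Y k x ^+ 2)) <=
    Ex P (fun x => m%:R * be ^+ m.+1 * q x ^+ (m.+1 * 2) + al ^+ m.+1 * Y k x ^+ (m.+1 * 2)).
  apply: Ex_le => [||x].
  - by apply/tame_Int/tameZ/tameM; exact: tameX.
  - by apply/tame_Int/tameD; apply/tameZ; exact: tameX.
  have := weighted_AGM m (mulr_ge0 (ltW be0) (sqr_ge0 (q x)))
    (mulr_ge0 (ltW al0) (sqr_ge0 (Y k x))).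
  rewrite !(exprMn _ be) !(exprMn _ al) -!exprM ![(2 * _)%N]mulnC.
  by congr (_ <= _); ring.
move: h; rewrite ExZ; last by apply/tame_Int/tameM; exact: tameX.
rewrite ExD; [|by apply/tame_Int/tameZ; exact: tameX..].
rewrite !ExZ; [|by apply/tame_Int; exact: tameX..].
have := Ex_lin_even_le (fun i => a i * b i k) m.+1; rewrite -/(Y k) -/(v k) -/be.
move: (Ex P _) (Ex P _) (Ex P _) => A B C hC h.
rewrite -(ler_pM2l (exprn_gt0 m be0)).
apply: (@le_trans _ _ (m%:R * be ^+ m.+1 * A + al ^+ m.+1 * C)).
  by move: h; congr (_ <= _); ring.
apply: (@le_trans _ _ (m%:R * be ^+ m.+1 * A + al ^+ m.+1 * be ^+ m.+1)).
  by rewrite lerD2l ler_wpM2l// exprn_ge0// ltW.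
by rewrite exprS; rewrite le_eqVlt; apply/orP; left; apply/eqP; ring.
Qed.

(** Summing [Ex_q_Y_le] over [k] bounds [A = E q^(2m+2)] in terms of itself; a suitable weight [al]
    absorbs the term [m A]. *)
Lemma chaos2_even_moment m :
  Ex P (fun x => q x ^+ (m.+1 * 2)) <= (2 * m.+1%:R * norm2 P q) ^+ (m.+1 * 2).
Proof.
rewrite (_ : (_ * norm2 P q) ^+ _ = ((2 * m.+1%:R) ^+ 2 * norm2 P q ^+ 2) ^+ m.+1); last first.
  by rewrite mulnC exprM -exprMn.
rewrite sqr_norm2 Ex_q_sqr.
set V := \sum_k v k; have V0 : 0 <= V by exact: sumr_ge0.
set A := Ex P _.
have AE : A = 2 * (m * 2).+1%:R * \sum_k Ex P (fun x => q x ^+ (m * 2) * Y k x ^+ 2).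
  exact: (Ex_q_exp (m * 2)).
(* The factor [8] comes from [4 (2 m + 1) (m + 1) <= 8 (m + 1)^2]. *)
have key al : 0 < al -> m.+1%:R * al * A <= 8 * m.+1%:R ^+ 2 * V * (m%:R * A + al ^+ m.+1).
  move=> al0.
  have A0 : 0 <= A by apply: Ex_ge0 => x; rewrite exprM sqr_ge0.
  apply: (@le_trans _ _ (2 * (m * 2).+1%:R * (2 * m.+1%:R * V * (m%:R * A + al ^+ m.+1)))).
    rewrite {1}AE mulrCA ler_wpM2l// mulr_sumr /V mulr_sumr mulr_suml ler_sum// => k _.
    exact: Ex_q_Y_le.
  have S0 : 0 <= m%:R * A + al ^+ m.+1 by rewrite addr_ge0 ?mulr_ge0// exprn_ge0// ltW.
  by rewrite !mulrA ler_wpM2r// ler_wpM2r// -!natrM ler_nat; lia.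
(* The good weight vanishes with [V], in which case [al = 1] already gives [A <= 0]. *)
have [V00|V00] := eqVneq V 0.
  rewrite V00 !mulr0 expr0n/=; have := key 1 ltr01.
  by rewrite V00 mulr0 mul0r mulr1 pmulr_rle0.
(* This equals [8 (m + 1)^2 V], the factor in [key], so that [(m + 1) A <= m A + al^(m+1)]; as
   [E q^2 = 2 V], the power [al^(m+1)] is the claimed bound. *)
pose al := (2 * m.+1%:R) ^+ 2 * (2 * V).
have al0 : 0 < al by rewrite !mulr_gt0// ?exprn_gt0// lt_neqAle eq_sym V00.
have := key _ al0; rewrite (_ : 8 * _ * V = al); last by rewrite /al; ring.
rewrite -/al -mulrA mulrCA ler_pM2l// -natr1; lra.
Qed.

End chaos2_moments.

(** * Factorisation of Gram matrices *)

Section gram.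
Context (R : realType) (H : completeNormedModType R) (ip : {dot H for @idfun R}).

Lemma dotC u w : ip u w = ip w u.
Proof. by rewrite hermC expr0 mul1r. Qed.

Lemma dotBZl u v w (a : R) : ip (u - a *: v) w = ip u w - a * ip v w.
Proof. by rewrite linearBl linearZl_LR. Qed.

Lemma dotBZr u v w (a : R) : ip w (u - a *: v) = ip w u - a * ip w v.
Proof. by rewrite dotC dotBZl ![ip _ w]dotC. Qed.

(* Gram-Schmidt: the functionals are the coordinates in an orthonormal basis. *)
Lemma gram_factorization (s : seq H) : exists ls : seq (H -> R),
  forall u w, u \in 0 :: s -> w \in 0 :: s -> ip u w = \sum_(l <- ls) l u * l w.
Proof.
(* The induction is on the length because the tail is replaced by its projections. *)
elim: {s}(size s) {-2}s (erefl (size s)) => [|n IH] [|v s]//= => [_|[sn]].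
  exists [::] => u w; rewrite !inE => /eqP -> _.
  by rewrite big_nil linear0l.
have [v0|v0] := eqVneq v 0.
  have [ls hls] := IH s sn; exists ls => u w us ws; apply: hls; rewrite v0 in us ws.
    by move: us; rewrite !inE => /orP[->//|].
  by move: ws; rewrite !inE => /orP[->//|].
have c0 : 0 < ip v v by exact: neq0_dnorm_gt0.
set c := ip v v in c0.
(* Projection onto the orthogonal complement of [v]. It sends [v] to [0], which is why [0] is
   adjoined to the list. *)
pose proj u := u - (ip u v / c) *: v.
have [|ls hls] := IH (map proj s); first by rewrite size_map.
have projP u : u \in [:: 0, v & s] -> proj u \in 0 :: map proj s.
  rewrite !inE => /or3P[/eqP->|/eqP->|us].
  - by rewrite /proj linear0l mul0r scale0r subr0 eqxx.
  - by rewrite /proj mulfV ?gt_eqF// scale1r subrr eqxx.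
  - by rewrite map_f// orbT.
exists ((fun u => ip u v / Num.sqrt c) :: map (fun l => l \o proj) ls) => u w us ws.
rewrite big_cons big_map -(hls _ _ (projP _ us) (projP _ ws)) /proj.
have -> : ip u v / Num.sqrt c * (ip w v / Num.sqrt c) = ip u v * ip w v / c.
  by rewrite mulrACA -invfM -expr2 sqr_sqrtr ?ltW.
rewrite dotBZl !dotBZr -/c (dotC v w).
by field; rewrite gt_eqF.
Qed.

End gram.

(** * Entropy bounds from exponential moments *)

Section duality_bounds.
Context d (T : measurableType d) (R : realType) (P : probability T R) (f : T -> R).
Hypothesis lf : f \in Lfun P 2%:E.
Hypothesis f_ge0 : {ae P, forall x, 0 <= f x}.
Hypothesis f_norm1 : 'N[P]_1[EFin \o f]%E = 1%E.
Implicit Types (q : T -> R) (k c t : R).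

(** Stated at a single [t], so that each use fixes its own range: all [t >= 0] in order 1,
    [t |q| <= c] in order 2. *)
Definition mgf_le q k t : Prop :=
  Int P (fun x => expR (t * q x)) /\
  Ex P (fun x => expR (t * q x)) <= expR (k * t ^+ 2 * norm2 P q ^+ 2).

Lemma mgf_le_duality q k t : q \in Lfun P 2%:E -> mgf_le q k t ->
  t * Ex P (fun x => f x * q x) <= Ent P f + k * t ^+ 2 * norm2 P q ^+ 2.
Proof.
move=> lq [It Et]; have ltq : (fun x => t * q x) \in Lfun P 2%:E.
  rewrite (_ : (fun _ => _) = t \o* q); first by apply: Lfun_scale => //; rewrite ler1n.
  by apply/funext => x /=; rewrite mulrC.
have := entropy_duality lf f_ge0 f_norm1 ltq It Et.
congr (_ <= _); rewrite -ExZ; last exact: Lfun2_IntM.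
by apply: eq_Rintegral => x _; rewrite mulrCA.
Qed.

Lemma subgaussian_duality q k : q \in Lfun P 2%:E -> 0 < k ->
  (forall t, 0 <= t -> mgf_le q k t) ->
  Ex P (fun x => f x * q x) <= (1 + k) * Num.sqrt (Ent P f) * norm2 P q.
Proof.
move=> lq k0 mgf; apply: le_of_mul_le_sqr => //; rewrite ?norm2_ge0 ?Ent_ge0//.
by move=> t t0; exact/mgf_le_duality/mgf.
Qed.

Lemma subexponential_duality q k c : q \in Lfun P 2%:E -> 0 < k -> 0 < c ->
  (forall t, 0 <= t -> t * norm2 P q <= c -> mgf_le q k t) ->
  Ex P (fun x => f x * q x) <=
  (c^-1 + k * c) * Num.max (Num.sqrt (Ent P f)) (Ent P f) * norm2 P q.
Proof.
move=> lq k0 c0 mgf; apply: le_of_mul_le_sqr_bounded => //; rewrite ?norm2_ge0 ?Ent_ge0//.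
by move=> t t0 tc; exact/mgf_le_duality/mgf.
Qed.

End duality_bounds.

(** * Hermite polynomials of degree 1 and 2 *)

Section hermite_polynomials.
Context (R : realType).
Local Notation w := (fun y : R => expR (- (y ^+ 2 / 2))).

Lemma is_derive_gauss_weight (x : R) : is_derive x 1 w (- x * w x).
Proof.
have Dg : is_derive x 1 (fun y : R => - (y ^+ 2 / 2)) (- x).
  rewrite (_ : (fun y => _) = - (2^-1 *: (@id R ^+ 2))); last first.
    by apply/funext => y /=; rewrite fctE /GRing.exp /= /GRing.scale /= mulrC.
  apply: is_derive_eq; rewrite /GRing.scale /=. lra.
have := @is_derive1_comp R expR _ x _ _ (is_derive_expR _) Dg.
by rewrite mulrC.
Qed.

Lemma derive1_gauss_weight : derive1 w = (fun x => - x * w x).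
Proof. by apply/funext => x; rewrite derive1E; case: (is_derive_gauss_weight x). Qed.

Lemma hermite1 (x : R) : hermite 1 x = x.
Proof.
rewrite /hermite derive1n1 derive1_gauss_weight expr1 sqrtr1 divr1.
rewrite mulrCA -!mulrA -expRD subrr expR0 mulr1; ring.
Qed.

Lemma hermite2 (x : R) : hermite 2 x = (Num.sqrt 2)^-1 * (x ^+ 2 - 1).
Proof.
rewrite /hermite derive1nS derive1n1 derive1_gauss_weight.
have D : is_derive x 1 (fun x => - x * w x) ((x ^+ 2 - 1) * w x).
  have Dw := is_derive_gauss_weight x.
  rewrite (_ : (fun x => _) = (- @id R) * w); last by [].
  by apply: is_derive_eq; rewrite /GRing.scale /= fctE; ring.
rewrite derive1E derive_val expr2 mulN1r opprK mul1r.
have E : expR (x ^+ 2 / 2) * expR (- (x ^+ 2 / 2)) = 1 by rewrite -expRD subrr expR0.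
rewrite (_ : 2`!%:R = 2 :> R)//.
transitivity (expR (x ^+ 2 / 2) * expR (- (x ^+ 2 / 2)) * ((Num.sqrt 2)^-1 * (x ^+ 2 - 1))).
  by ring.
by rewrite E mul1r.
Qed.

End hermite_polynomials.

(** * Bounds for the Wiener chaoses *)

Section gaussian_case.
Context (R : realType).
Local Notation k2 := (4 * expR 1 ^+ 2 : R).
Local Notation c2 := ((2 * expR 1)^-1 : R).
Context (H : completeNormedModType R) (ip : {dot H for @idfun R}).
Context d (T : measurableType d) (P : probability T R) (W : H -> {RV P >-> R}).
Hypothesis ip_norm : norm_from_dot ip.
Hypothesis isoW : isonormal W ip.

Lemma Ex_W h : Ex P (W h) = 0.
Proof. by have [[_ /(_ h)]] := isoW; rewrite unlock => + _; rewrite /Rintegral => ->. Qed.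

Lemma Ex_WM h k : Ex P (fun x => W h x * W k x) = ip h k.
Proof. by have [_ /(_ h k)] := isoW; rewrite unlock /Rintegral => ->. Qed.

Section family.
Context (n : nat) (a : 'I_n -> R) (h : 'I_n -> H).
Hypothesis h1 : forall i, `|h i| = 1.
Let X i : T -> R := W (h i).

Let mX i : measurable_fun [set: T] (X i).
Proof. exact: measurable_funPT. Qed.

Let gX c : gaussian_rv P (fun x => \sum_i c i * X i x).
Proof. by have [[+ _] _] := isoW; exact. Qed.

Let X0 i : Ex P (X i) = 0. Proof. exact: Ex_W. Qed.

Let X1 i : Ex P (fun x => X i x * X i x) = 1.
Proof. by rewrite Ex_WM -ip_norm h1 expr1n. Qed.

(** [lin X a] is itself a centered Gaussian variable, so the bound is an equality. *)
Lemma wiener1_mgf t : mgf_le P (lin X a) 2^-1 t.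
Proof.
split; first by have [_] := exp_tame_lin mX gX a; exact.
rewrite (centered_gaussian_rv_mgf (measurable_lin mX a) (gX a) (Ex_lin mX gX X0 a)).
by rewrite sqr_norm2 mulrC mulrA.
Qed.

(** The covariances are the inner products of the [h i], so Gram-Schmidt on these finitely many
    vectors supplies the factor [b] of [chaos2_even_moment]. *)
Lemma wiener2_mgf t : 0 <= t -> t * norm2 P (chaos2 X a) <= (2 * expR 1)^-1 ->
  mgf_le P (chaos2 X a) (4 * expR 1 ^+ 2) t.
Proof.
have [ls lsP] := gram_factorization ip [seq h i | i <- enum 'I_n].
apply: mgf_le_of_even_moments => //.
- exact: tame_chaos2.
- rewrite Ex_sum => [|i]; last first.
    apply/tame_Int/tameZ/tameB; last exact: tame_cst.
    exact/tameX/(tame_X mX gX).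
  rewrite big1// => i _; rewrite ExZ; last first.
    by apply/tame_Int/tameB; [exact/tameX/(tame_X mX gX)|exact: tame_cst].
  rewrite ExB; [|by apply/tame_Int/tameX/(tame_X mX gX)|exact: Int_cst].
  by under eq_Rintegral do rewrite expr2; rewrite X1 Ex_cst subrr mulr0.
- exact: norm2_ge0.
- apply: (@chaos2_even_moment _ _ _ _ _ _ mX gX X0 a X1 (size ls)
    (fun i k => tnth (in_tuple ls) k (h i))) => i j.
  rewrite Ex_WM lsP ?inE ?map_f ?mem_enum ?orbT//.
  by rewrite big_tnth.
Qed.

End family.

Context (f : T -> R).
Hypothesis lf : f \in Lfun P 2%:E.
Hypothesis f_ge0 : {ae P, forall x, 0 <= f x}.
Hypothesis f_norm1 : 'N[P]_1[EFin \o f]%E = 1%E.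

Lemma wiener_span m q :
  linear_span [set (fun x => hermite m (W h x)) | h in [set h : H | `|h| = 1]] q ->
  exists n (a : 'I_n -> R) (h : 'I_n -> H), (forall i, `|h i| = 1) /\
    q = (fun x => \sum_i a i * hermite m (W (h i) x)).
Proof.
move=> [n [a [e [eP ->]]]].
have /choice[h hP] : forall i, exists h : H, `|h| = 1 /\ (fun x => hermite m (W h x)) = e i.
  by move=> i; have [h] := eP i; exists h.
exists n, a, h; split=> [i|]; first by have [] := hP i.
by apply/funext => x; apply: eq_bigr => i _; have [_ <-] := hP i.
Qed.

Lemma wiener_chaos1_bound g : is_orth_proj P (wiener_chaos W 1) f g ->
  ('N[P]_(2%:E)[EFin \o g] <= ((1 + 2^-1) * Num.sqrt (Ent P f))%:E)%E.
Proof.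
apply: (proj_norm2_le lf) => [|q /wiener_span[n [a [h [h1 qE]]]]].
  by rewrite mulr_ge0 ?sqrtr_ge0// addr_ge0.
have -> : q = lin (fun i => W (h i) : T -> R) a.
  by rewrite qE; apply/funext => x; apply: eq_bigr => i _; rewrite hermite1.
have lq : lin (fun i => W (h i) : T -> R) a \in Lfun P 2%:E.
  apply: tame_Lfun2; apply: tame_lin => [i|c]; first exact: measurable_funPT.
  by have [[+ _] _] := isoW; exact.
split => //; apply: (subgaussian_duality lf f_ge0 f_norm1 lq) => // t t0.
exact: wiener1_mgf.
Qed.

Lemma wiener_chaos2_bound g : is_orth_proj P (wiener_chaos W 2) f g ->
  ('N[P]_(2%:E)[EFin \o g] <=
    ((c2^-1 + k2 * c2) * Num.max (Num.sqrt (Ent P f)) (Ent P f))%:E)%E.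
Proof.
move=> og; have c0 : 0 < c2 by rewrite invr_gt0 mulr_gt0 ?expR_gt0.
have k0 : 0 < k2 by rewrite mulr_gt0 ?exprn_gt0 ?expR_gt0.
apply: (proj_norm2_le lf _ _ og) => [|q /wiener_span[n [a [h [h1 qE]]]]].
  apply: mulr_ge0; last by rewrite le_max sqrtr_ge0.
  by apply: addr_ge0; [rewrite invr_ge0 ltW|rewrite mulr_ge0// ltW].
have -> : q = chaos2 (fun i => W (h i) : T -> R) (fun i => a i / Num.sqrt 2).
  by rewrite qE; apply/funext => x; apply: eq_bigr => i _; rewrite hermite2 mulrA.
have lq : chaos2 (fun i => W (h i) : T -> R) (fun i => a i / Num.sqrt 2) \in Lfun P 2%:E.
  apply: tame_Lfun2; apply: tame_chaos2 => [i|b]; first exact: measurable_funPT.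
  by have [[+ _] _] := isoW; exact.
split => //; apply: (subexponential_duality lf f_ge0 f_norm1 lq) => // t t0 tc.
exact: wiener2_mgf.
Qed.

End gaussian_case.

(** * Rademacher chaos *)

Section fair_signs.
Context (R : realType) (P : probability signs R).
Hypothesis unifP : uniform_product P.
Implicit Types (F : signs -> R) (n i : nat) (b : bool).

Definition sign_at (w : signs) i : bool := (w : nat -> bool) i.

Definition upd (w : signs) n b : signs := fun i => if i == n then b else sign_at w i.

(** These cylinder functions reduce expectations to finite sums over the first [n] signs. *)
Definition depends_below n F : Prop :=
  forall w w' : signs, (forall i, (i < n)%N -> sign_at w i = sign_at w' i) -> F w = F w'.

Definition cyl n (s : {ffun 'I_n -> bool}) : set signs :=
  [set w | forall i : 'I_n, s i = sign_at w i].

(** The value [false] from [n] on is a default, invisible to functions of the first [n] signs. *)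
Definition ext n (s : {ffun 'I_n -> bool}) : signs :=
  fun i => if insub i is Some j then s j else false.

Lemma measurable_sign_at i b : measurable [set w : signs | sign_at w i = b].
Proof.
apply: sub_sigma_algebra; exists i => //=; exists [set b] => //.
by rewrite setTI; apply/seteqP; split.
Qed.

Lemma measurable_cyl n (s : {ffun 'I_n -> bool}) : measurable (cyl s).
Proof.
have -> : cyl s = \bigcap_(i in [set: 'I_n]) [set w | sign_at w i = s i].
  by apply/seteqP; split => [w sw i _|w sw i]; rewrite /= ?sw//; exact/esym/sw.
apply: fin_bigcap_measurable => [|i _]; [exact: finite_finset|exact: measurable_sign_at].
Qed.

Lemma fair_bernoulli_set1 b : bernoulli_prob (2^-1 : R) [set b] = (2^-1)%:E.
Proof.
rewrite bernoulli_probE; last by lra.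
have E c : (c \in [set b]) = (c == b) by apply/idP/eqP; rewrite inE.
rewrite !diracE !E; case: b {E}; rewrite /= mule1 mule0 ?adde0 ?add0e//.
by congr EFin; rewrite -[LHS]/(1 - 2^-1); lra.
Qed.

Lemma prob_cyl n (s : {ffun 'I_n -> bool}) : P (cyl s) = (2^-1 ^+ n)%:E.
Proof.
have -> : cyl s = [set w | forall i : 'I_n, [set s i] ((w : nat -> bool) i)].
  by apply/seteqP; split => w /= h i; have := h i.
rewrite (unifP (fun i : 'I_n => [set s i])); under eq_bigr do rewrite fair_bernoulli_set1.
by rewrite prodEFin prodr_const card_ord.
Qed.

Lemma depends_below_expand n F w : depends_below n F ->
  F w = \sum_(s : {ffun 'I_n -> bool}) F (ext s) * \1_(cyl s) w.
Proof.
move=> dF; rewrite (bigD1 [ffun i : 'I_n => sign_at w i])//= big1 ?addr0 => [|s sN].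
  rewrite indicE mem_set ?mulr1; last by move=> i; rewrite ffunE.
  apply: dF => i ltin; rewrite /sign_at /ext insubT ffunE //.
rewrite indicE memNset ?mulr0// => sw; move/eqP: sN; apply.
by apply/ffunP => i; rewrite ffunE sw.
Qed.

Lemma depends_below_Int n F : depends_below n F -> Int P F.
Proof.
move=> dF; rewrite (_ : F = fun w => \sum_(s : {ffun 'I_n -> bool}) F (ext s) * \1_(cyl s) w).
  by apply: Int_sum => s; apply: IntZ; apply: integrable_indic; exact: measurable_cyl.
by apply/funext => w; exact: depends_below_expand.
Qed.

Lemma depends_below_tame n F : depends_below n F -> tame P F.
Proof.
move=> dF; split; first exact: Int_measurable (depends_below_Int dF).
by move=> k; apply: (@depends_below_Int n) => w w' /dF ->.
Qed.

Lemma Ex_indic (A : set signs) : measurable A -> Ex P (\1_A : signs -> R) = fine (P A).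
Proof. by move=> mA; rewrite /Rintegral integral_indic// setIT. Qed.

(** Independence of the sign [n] from the earlier ones: refining a cylinder by one more sign halves
    its probability. *)
Lemma Ex_mul_sign_at n F b : depends_below n F ->
  Ex P (fun w => F w * (sign_at w n == b)%:R) = 2^-1 * Ex P F.
Proof.
move=> dF.
have mI (A : set signs) (mA : measurable A) : Int P (\1_A : signs -> R) by exact: integrable_indic.
pose A (s : {ffun 'I_n -> bool}) := cyl s `&` [set w | sign_at w n = b].
have mA s : measurable (A s) by apply: measurableI; [exact: measurable_cyl|exact: measurable_sign_at].
transitivity (\sum_s F (ext s) * fine (P (A s))).
  under eq_bigr do rewrite -Ex_indic// -ExZ ?mI//.
  rewrite -Ex_sum => [|s]; last by apply: IntZ; exact: mI.
  apply: eq_Rintegral => w _; rewrite (depends_below_expand w dF) mulr_suml.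
  apply: eq_bigr => s _; rewrite /A indicI -mulrA; congr (_ * (_ * _)).
  by rewrite indicE; case: eqP => h; [rewrite mem_set|rewrite memNset].
transitivity (2^-1 * \sum_(s : {ffun 'I_n -> bool}) F (ext s) * fine (P (cyl s))); last first.
  congr (_ * _); have mc (s : {ffun 'I_n -> bool}) : measurable (cyl s) by exact: measurable_cyl.
  under eq_bigr do rewrite -Ex_indic// -ExZ ?mI//.
  rewrite -Ex_sum => [|s]; last by apply/IntZ/mI.
  by apply: eq_Rintegral => w _; rewrite (depends_below_expand w dF).
rewrite mulr_sumr; apply: eq_bigr => s _; rewrite mulrCA; congr (_ * _).
pose t : {ffun 'I_n.+1 -> bool} := [ffun i : 'I_n.+1 => if unlift ord_max i is Some j then s j else b].
have -> : A s = cyl t.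
  apply/seteqP; split => w /=.
    move=> [sw wb] i; rewrite ffunE; case: unliftP => [j ->|->]; last by [].
    by rewrite sw lift_max.
  move=> tw; split=> [i|]; last by have := tw ord_max; rewrite ffunE unlift_none => ->.
  by have := tw (lift ord_max i); rewrite ffunE liftK lift_max.
by rewrite !prob_cyl /= exprS.
Qed.

(** [F] is split along the two values of the sign [n], and [Ex_mul_sign_at] averages each part. The
    inductions on the number of signs rest on this. *)
Lemma Ex_succ n F : depends_below n.+1 F ->
  Ex P F = 2^-1 * Ex P (fun w => F (upd w n true) + F (upd w n false)).
Proof.
move=> dF; have dFb b : depends_below n (fun w => F (upd w n b)).
  move=> w w' ww'; apply: dF => i; rewrite ltnS leq_eqVlt /sign_at /upd.
  by case: eqP => //= _; exact: ww'.
have dFI b : Int P (fun w => F (upd w n b) * (sign_at w n == b)%:R).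
  apply: (@depends_below_Int n.+1) => w w' ww'; rewrite (ww' n)//; congr (_ * _).
  by apply: dFb => i ltin; apply: ww'; exact: ltnW.
rewrite ExD; [|exact: (depends_below_Int (dFb _))..].
rewrite mulrDr -(Ex_mul_sign_at true (dFb true)) -(Ex_mul_sign_at false (dFb false)) -ExD//.
apply: eq_Rintegral => w _.
have updE b : sign_at w n = b -> upd w n b = w.
  by move=> wb; apply/funext => i; rewrite /upd; case: eqP => [->|].
by case wn : (sign_at w n); rewrite /= mulr1 mulr0 ?addr0 ?add0r updE.
Qed.

End fair_signs.

(** * The bound [cosh u <= exp (u^2 / 2)] *)

Section cosh.
Context (R : realType).

Lemma exp2_fact_le k : (2 ^ k * k`! <= (k * 2)`!)%N.
Proof.
elim: k => [//|k IH].
rewrite mulSn !addSn add0n !factS expnS.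
have := leq_mul (leq_mul (leqnn 2) (leqnn k.+1)) IH; nia.
Qed.

(** Termwise comparison of power series, by [2^k k! <= (2 k)!]. *)
Lemma cosh_le_expR_sqr (u : R) : expR u + expR (- u) <= 2 * expR (u ^+ 2 / 2).
Proof.
have h := @cosh_series_cvg R u; rewrite -(cvg_lim _ h)//.
apply: limr_le; first by apply/cvg_ex; exists (expR u + expR (- u)).
apply: nearW => n; rewrite ler_wpM2l//.
apply: (@le_trans _ _ (series (exp_coeff (u ^+ 2 / 2)) n)); last first.
  apply: nondecreasing_cvgn_le; last exact: is_cvg_series_exp_coeff.
  apply/nondecreasing_series => k _ _; apply: exp_coeff_ge0.
  by rewrite divr_ge0// sqr_ge0.
rewrite /series /= big_mkord; apply: ler_sum => k _; rewrite /exp_coeff /=.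
have -> : (u ^+ 2 / 2) ^+ k = u ^+ (k * 2) / 2 ^+ k by rewrite mulnC exprM expr_div_n.
rewrite -mulrA ler_wpM2l//; first by rewrite exprM sqr_ge0.
rewrite -invfM -natrX -natrM lef_pV2 ?posrE ?ltr0n ?muln_gt0 ?expn_gt0 ?fact_gt0//.
by rewrite ler_nat exp2_fact_le.
Qed.

End cosh.

(** * Linear and quadratic forms in finitely many signs *)

Section rademacher_sums.
Context (R : realType) (P : probability signs R).
Hypothesis unifP : uniform_product P.
Implicit Types (b : nat -> R) (M : nat -> nat -> R) (n : nat) (w : signs).
Local Notation eps i w := (@rademacher R i w).

Definition rad1 n b : signs -> R := fun w => \sum_(i < n) b i * eps i w.
(** The diagonal is kept because integrating out a sign creates diagonal entries. *)
Definition rad2 n M : signs -> R :=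
  fun w => \sum_(i < n) \sum_(j < n) M i j * (eps i w * eps j w).
(** The squared Hilbert-Schmidt norm of the truncated matrix. *)
Definition hs n M : R := \sum_(i < n) \sum_(j < n) M i j ^+ 2.

Lemma sqr_rademacher i w : eps i w ^+ 2 = 1.
Proof. by rewrite /rademacher; case: ifP => _; rewrite ?expr1n ?sqrrN ?expr1n. Qed.

Lemma rademacher_upd_lt n i c w : (i < n)%N -> eps i (upd w n c) = eps i w.
Proof. by move=> lin; rewrite /rademacher /upd (ltn_eqF lin). Qed.

Lemma rademacher_upd n c w : eps n (upd w n c) = if c then 1 else -1.
Proof. by rewrite /rademacher /upd eqxx. Qed.

Lemma rad1_upd n b c w : rad1 n b (upd w n c) = rad1 n b w.
Proof. by apply: eq_bigr => i _; rewrite rademacher_upd_lt. Qed.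

Lemma rad2_upd n M c w : rad2 n M (upd w n c) = rad2 n M w.
Proof.
by apply: eq_bigr => i _; apply: eq_bigr => j _; rewrite !rademacher_upd_lt.
Qed.

Lemma rad1S n b w : rad1 n.+1 b w = rad1 n b w + b n * eps n w.
Proof. by rewrite /rad1 big_ord_recr. Qed.

Lemma rad2S n M w : (forall i j, M i j = M j i) ->
  rad2 n.+1 M w = rad2 n M w + 2 * eps n w * rad1 n (M n) w + M n n.
Proof.
move=> symM; rewrite /rad2 big_ord_recr/= big_ord_recr/=.
under eq_bigr do rewrite big_ord_recr/=.
rewrite big_split/= -expr2 sqr_rademacher mulr1 -!addrA; congr (_ + _).
rewrite addrA; congr (_ + _); rewrite /rad1 mulr_sumr -big_split/=.
by apply: eq_bigr => i _; rewrite (symM i n); ring.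
Qed.

Lemma hsS n M : (forall i j, M i j = M j i) ->
  hs n.+1 M = hs n M + 2 * (\sum_(i < n) M n i ^+ 2) + M n n ^+ 2.
Proof.
move=> symM; rewrite /hs big_ord_recr/= big_ord_recr/=.
under eq_bigr do rewrite big_ord_recr/=.
rewrite big_split/= -!addrA; congr (_ + _).
rewrite addrA; congr (_ + _); rewrite mulr_sumr -big_split/=.
by apply: eq_bigr => i _; rewrite (symM i n); ring.
Qed.

Lemma hs_ge0 n M : 0 <= hs n M.
Proof. by apply: sumr_ge0 => i _; apply: sumr_ge0 => j _; exact: sqr_ge0. Qed.

Lemma depends_below_rad1 n b : depends_below n (rad1 n b).
Proof.
move=> w w' ww'; apply: eq_bigr => i _; congr (_ * _).
by rewrite /rademacher; have := ww' i (ltn_ord i); rewrite /sign_at => ->.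
Qed.

Lemma depends_below_rad2 n M : depends_below n (rad2 n M).
Proof.
move=> w w' ww'; apply: eq_bigr => i _; apply: eq_bigr => j _; congr (_ * (_ * _)).
  by rewrite /rademacher; have := ww' i (ltn_ord i); rewrite /sign_at => ->.
by rewrite /rademacher; have := ww' j (ltn_ord j); rewrite /sign_at => ->.
Qed.

Lemma depends_below_comp n (phi : R -> R) (F : signs -> R) :
  depends_below n F -> depends_below n (phi \o F).
Proof. by move=> dF w w' /dF /= ->. Qed.

Lemma tame_rad1 n b : tame P (rad1 n b).
Proof. exact/depends_below_tame/depends_below_rad1. Qed.

Lemma tame_rad2 n M : tame P (rad2 n M).
Proof. exact/depends_below_tame/depends_below_rad2. Qed.

Lemma Ex_sqr_rad1 n b : Ex P (fun w => rad1 n b w ^+ 2) = \sum_(i < n) b i ^+ 2.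
Proof.
elim: n => [|n IH].
  by rewrite big_ord0; under eq_Rintegral do rewrite /rad1 big_ord0 expr0n; rewrite Ex_cst.
rewrite (Ex_succ unifP (n := n)); last first.
  exact: (depends_below_comp (fun x => x ^+ 2) (@depends_below_rad1 n.+1 b)).
under eq_Rintegral do rewrite !rad1S !rad1_upd !rademacher_upd.
rewrite big_ord_recr/= -IH.
rewrite (_ : (fun w => _) = fun w => 2 * (rad1 n b w ^+ 2 + b n ^+ 2)); last first.
  by apply/funext => w; ring.
have I2 : Int P (fun w => rad1 n b w ^+ 2) by exact/tame_Int/tameX/tame_rad1.
rewrite ExZ ?ExD ?Ex_cst//; [by field|exact: Int_cst|].
by apply: IntD => //; exact: Int_cst.
Qed.

(** Averaging over the last sign kills the cross term; the factor [2] arises because each unordered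
    pair occurs twice in [rad2]. *)
Lemma Ex_sqr_rad2 n M : (forall i j, M i j = M j i) -> (forall i, M i i = 0) ->
  Ex P (fun w => rad2 n M w ^+ 2) = 2 * hs n M.
Proof.
move=> symM M0; elim: n => [|n IH].
  rewrite /hs big_ord0 mulr0.
  by under eq_Rintegral do rewrite /rad2 big_ord0 expr0n; rewrite Ex_cst.
rewrite (Ex_succ unifP (n := n)); last first.
  exact: (depends_below_comp (fun x => x ^+ 2) (@depends_below_rad2 n.+1 M)).
under eq_Rintegral do rewrite !rad2S// !rad2_upd !rad1_upd !rademacher_upd M0.
rewrite hsS// M0 expr0n addr0 mulrDr -IH -Ex_sqr_rad1.
transitivity (2^-1 * Ex P (fun w => 2 * (rad2 n M w ^+ 2 + 4 * rad1 n (M n) w ^+ 2))).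
  by congr (_ * _); apply: eq_Rintegral => w _; ring.
have I1 : Int P (fun w => rad1 n (M n) w ^+ 2) by exact/tame_Int/tameX/tame_rad1.
have I2 : Int P (fun w => rad2 n M w ^+ 2) by exact/tame_Int/tameX/tame_rad2.
have I3 := IntZ 4 I1; have I4 := IntD I2 I3.
by rewrite ExZ// ExD// ExZ//; field.
Qed.

(** Each sign contributes a factor [cosh (b i) <= exp (b i^2 / 2)]. *)
Lemma Ex_expR_rad1_le n b :
  Ex P (fun w => expR (rad1 n b w)) <= expR (2^-1 * \sum_(i < n) b i ^+ 2).
Proof.
elim: n => [|n IH].
  rewrite big_ord0 mulr0; under eq_Rintegral do rewrite /rad1 big_ord0.
  by rewrite Ex_cst.
have Ie : Int P (fun w => expR (rad1 n b w)).
  apply: (@depends_below_Int _ P n).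
  exact: (depends_below_comp (@expR R) (@depends_below_rad1 n b)).
rewrite (Ex_succ unifP (n := n)); last first.
  exact: (depends_below_comp (@expR R) (@depends_below_rad1 n.+1 b)).
under eq_Rintegral do rewrite !rad1S !rad1_upd !rademacher_upd mulr1 mulrN1 !expRD -mulrDr mulrC.
rewrite ExZ// big_ord_recr/= mulrDr expRD.
have := cosh_le_expR_sqr (b n); have := expR_gt0 (b n); have := expR_gt0 (- b n).
have E0 : 0 <= Ex P (fun w => expR (rad1 n b w)) by apply: Ex_ge0 => w; exact: expR_ge0.
move: (expR (b n)) (expR (- b n)) => x y y0 x0 xy.
rewrite mulrA mulrC ler_pM//; first by rewrite mulr_ge0// addr_ge0// ltW.
by rewrite [2^-1 * b n ^+ 2]mulrC; lra.
Qed.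

(* Integrating out the last sign turns the symmetric matrix M into
   M' = M + m m^T, where m is the last column of M. *)
Lemma Ex_expR_rad2_le n M : (forall i j, M i j = M j i) -> hs n M <= 4^-1 ->
  Ex P (fun w => expR (2^-1 * rad2 n M w)) <=
  expR (2^-1 * \sum_(i < n) M i i + hs n M).
Proof.
elim: n M => [|n IH] M symM hM.
  rewrite /hs !big_ord0 mulr0 addr0; under eq_Rintegral do rewrite /rad2 big_ord0 mulr0.
  by rewrite Ex_cst.
have dexp m N : depends_below m (fun w => expR (2^-1 * rad2 m N w)).
  exact: (depends_below_comp (fun x => expR (2^-1 * x)) (@depends_below_rad2 m N)).
rewrite (Ex_succ unifP (dexp n.+1 M)).
pose m := M n; pose M' i j := M i j + m i * m j.
pose t := \sum_(i < n) m i ^+ 2; have t0 : 0 <= t by apply: sumr_ge0 => i _; exact: sqr_ge0.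
have symM' i j : M' i j = M' j i by rewrite /M' symM mulrC.
have rad2M' w : rad2 n M' w = rad2 n M w + rad1 n m w ^+ 2.
  rewrite expr2 /rad2 {1}/rad1 mulr_suml -big_split/=; apply: eq_bigr => i _.
  rewrite /rad1 mulr_sumr -big_split/=; apply: eq_bigr => j _.
  by rewrite /M'; ring.
have trM' : \sum_(i < n) M' i i = \sum_(i < n) M i i + t.
  by rewrite -big_split/=; apply: eq_bigr => i _; rewrite /M' expr2.
have := hsS n symM; rewrite -/m -/t => hSM.
have d0 := sqr_ge0 (M n n); have h0 := hs_ge0 n M.
(* The cross term [2 S] is at most [t]: the sum of the squares [(2 t M_ij - m_i m_j)^2] gives
   [4 t^2 hs n M - 4 t S + t^2 >= 0], which is divided by [t] and combined with [hs n M <= 1/4]. *)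
have hM' : hs n M' <= hs n M + t + t ^+ 2.
  have E2 : t ^+ 2 = \sum_(i < n) \sum_(j < n) (m i * m j) ^+ 2.
    rewrite expr2 {1}/t mulr_suml; apply: eq_bigr => i _.
    by rewrite mulr_sumr; apply: eq_bigr => j _; rewrite exprMn.
  pose S := \sum_(i < n) \sum_(j < n) M i j * (m i * m j).
  have -> : hs n M' = hs n M + 2 * S + t ^+ 2.
    rewrite E2 /hs /S mulr_sumr -!big_split/=; apply: eq_bigr => i _.
    rewrite mulr_sumr -!big_split/=; apply: eq_bigr => j _.
    by rewrite /M'; ring.
  rewrite lerD2r lerD2l.
  have sq u : u ^+ 2 = t ^+ 2 -> 0 <= (2 * u) ^+ 2 * hs n M + (- (4 * u)) * S + u ^+ 2.
    rewrite E2 => uE; have -> : (2 * u) ^+ 2 * hs n M + (- (4 * u)) * S + u ^+ 2 =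
        \sum_(i < n) \sum_(j < n) (2 * u * M i j - m i * m j) ^+ 2.
      rewrite uE /hs /S !mulr_sumr -!big_split/=; apply: eq_bigr => i _.
      rewrite !mulr_sumr -!big_split/=; apply: eq_bigr => j _.
      by ring.
    by apply: sumr_ge0 => i _; apply: sumr_ge0 => j _; exact: sqr_ge0.
  have {}sq := sq t erefl.
  have [t00|tN] := eqVneq t 0.
    suff -> : S = 0 by rewrite t00 mulr0.
    have mi0 (i : 'I_n) : m i = 0.
      apply/eqP; rewrite -sqrf_eq0 -(negbK (_ == 0)); apply/negP => miN.
      have : 0 < t.
        rewrite /t (bigD1 i)//= ltr_wpDr ?sumr_ge0// => [j _|]; rewrite ?sqr_ge0//.
        by rewrite lt_neqAle eq_sym miN sqr_ge0.
      by rewrite t00 ltxx.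
    by rewrite /S big1// => i _; rewrite big1// => j _; rewrite mi0 mul0r mulr0.
  have tp : 0 < t by rewrite lt_neqAle eq_sym tN.
  rewrite -(ler_pM2l tp); nra.
(* Dropping the last row and column frees at least [2 t >= t + t^2], so the smallness condition is
   preserved. *)
have hM'4 : hs n M' <= 4^-1 by nra.
have Ie := depends_below_Int P (dexp n M').
(* The last sign produces [e^u + e^(-u) <= 2 e^(u^2/2)] with [u = rad1 n m w], and [u^2] is what
   [rad2 n M'] adds to [rad2 n M]. *)
apply: (@le_trans _ _ (expR (2^-1 * M n n) * Ex P (fun w => expR (2^-1 * rad2 n M' w)))).
  have IS : Int P (fun w => expR (2^-1 * rad2 n.+1 M (upd w n true)) +
      expR (2^-1 * rad2 n.+1 M (upd w n false))).
    apply: IntD; apply: (@depends_below_Int _ P n) => w w' ww';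
    by rewrite !rad2S// !rad2_upd !rad1_upd !rademacher_upd
         (depends_below_rad2 M ww') (depends_below_rad1 _ ww').
  rewrite -!ExZ//; apply: Ex_le => [||w]; [exact: IntZ..|].
  rewrite !rad2S// !rad2_upd !rad1_upd !rademacher_upd rad2M' -/m.
  have := cosh_le_expR_sqr (rad1 n m w).
  have -> : 2^-1 * (rad2 n M w + 2 * 1 * rad1 n m w + M n n) =
    2^-1 * M n n + 2^-1 * rad2 n M w + rad1 n m w by field.
  have -> : 2^-1 * (rad2 n M w + 2 * -1 * rad1 n m w + M n n) =
    2^-1 * M n n + 2^-1 * rad2 n M w - rad1 n m w by field.
  have -> : 2^-1 * (rad2 n M w + rad1 n m w ^+ 2) =
    2^-1 * rad2 n M w + rad1 n m w ^+ 2 / 2 by field.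
  rewrite !expRD.
  have := expR_gt0 (2^-1 * M n n); have := expR_gt0 (2^-1 * rad2 n M w).
  move: (expR (2^-1 * M n n)) (expR (2^-1 * rad2 n M w)) => x y y0 x0.
  have xy : 0 < x * y by exact: mulr_gt0.
  by move=> /(ler_wpM2l (ltW xy)); lra.
have := IH M' symM' hM'4; move/(ler_wpM2l (expR_ge0 (2^-1 * M n n)))/le_trans; apply.
(* The trace grows by [t / 2] and [hs] by at most [t + t^2]; since [t <= 1/8], both fit in the [2 t]
   of [hsS]. *)
rewrite -expRD ler_expR trM' big_ord_recr/= hSM; nra.
Qed.

End rademacher_sums.

(** * Bounds for the Rademacher chaoses *)

Section rademacher_case.
Context (R : realType) (P : probability signs R).
Hypothesis unifP : uniform_product P.
Local Notation k2 := (4 * expR 1 ^+ 2 : R).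
Local Notation c2 := ((2 * expR 1)^-1 : R).
Implicit Types (b : nat -> R) (M : nat -> nat -> R).

Lemma sum_delta_ord (N i : nat) (F : nat -> R) : (i < N)%N ->
  \sum_(j < N) (i == j)%:R * F j = F i.
Proof.
move=> iN; rewrite (bigD1 (Ordinal iN))//= eqxx mul1r big1 ?addr0// => j /eqP jN.
by case: eqP => [ij|]; rewrite ?mul0r//; case: jN; apply: val_inj.
Qed.

Lemma rademacher1_mgf n b t : mgf_le P (rad1 n b) 2^-1 t.
Proof.
have E : (fun w => expR (t * rad1 n b w)) = (fun w => expR (rad1 n (fun i => t * b i) w)).
  apply/funext => w; rewrite /rad1 mulr_sumr.
  by congr expR; apply: eq_bigr => i _; rewrite mulrA.
rewrite /mgf_le E; split.
  apply: (@depends_below_Int _ P n).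
  exact: (depends_below_comp (@expR R) (@depends_below_rad1 _ n _)).
apply: le_trans (Ex_expR_rad1_le unifP n _) _.
rewrite ler_expR sqr_norm2 (Ex_sqr_rad1 unifP) -mulrA ler_wpM2l// mulr_sumr.
by apply: ler_sum => i _; rewrite exprMn.
Qed.

(** Here [|q|^2 = hs n M / 2], so [c2 <= 1/4] puts [t M] in the range of [Ex_expR_rad2_le]. The
    trace being zero, this gives [exp (2 t^2 |q|^2)], and [k2 >= 16]. *)
Lemma rademacher2_mgf n M t : (forall i j, M i j = M j i) -> (forall i, M i i = 0) ->
  0 <= t -> t * norm2 P (fun w => 2^-1 * rad2 n M w) <= c2 ->
  mgf_le P (fun w => 2^-1 * rad2 n M w) k2 t.
Proof.
move=> symM M0 t0; set q : signs -> R := fun w => 2^-1 * rad2 n M w.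
have nq : norm2 P q ^+ 2 = 2^-1 * hs n M.
  have I2 : Int P (fun w => rad2 n M w ^+ 2) by exact/tame_Int/tameX/tame_rad2.
  rewrite sqr_norm2 /q; under eq_Rintegral do rewrite exprMn.
  by rewrite ExZ// (Ex_sqr_rad2 unifP)//; field.
have N0 := norm2_ge0 P q; set N := norm2 P q in N0 nq * => tN.
have e2 : 2 <= expR 1 :> R by have := expR_ge1Dx (1 : R); lra.
have c4 : c2 <= 4^-1 by rewrite lef_pV2 ?posrE; lra.
have hsE : hs n (fun i j => t * M i j) = t ^+ 2 * hs n M.
  rewrite /hs mulr_sumr; apply: eq_bigr => i _; rewrite mulr_sumr.
  by apply: eq_bigr => j _; rewrite exprMn.
have E : (fun w => expR (t * q w)) = (fun w => expR (2^-1 * rad2 n (fun i j => t * M i j) w)).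
  apply/funext => w; congr expR; rewrite /q mulrCA; congr (_ * _).
  rewrite /rad2 mulr_sumr; apply: eq_bigr => i _; rewrite mulr_sumr.
  by apply: eq_bigr => j _; rewrite -mulrA.
rewrite /mgf_le E; split.
  apply: (@depends_below_Int _ P n).
  exact: (depends_below_comp (fun x => expR (2^-1 * x)) (@depends_below_rad2 _ n _)).
have tN2 : t ^+ 2 * N ^+ 2 <= 4^-1 ^+ 2.
  by rewrite -exprMn lerXn2r ?nnegrE ?mulr_ge0 ?(le_trans tN).
apply: le_trans (Ex_expR_rad2_le unifP _ _) _ => [i j||].
- by rewrite symM.
- by rewrite hsE; move: tN2; rewrite nq; lra.
rewrite ler_expR big1 => [|i _]; last by rewrite M0 mulr0.
rewrite mulr0 add0r hsE -/N nq.
have h0 := hs_ge0 n M; have : 0 <= t ^+ 2 * hs n M by rewrite mulr_ge0// sqr_ge0.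
have : 4 <= expR 1 ^+ 2 :> R by nra.
nra.
Qed.

Context (f : signs -> R).
Hypothesis lf : f \in Lfun P 2%:E.
Hypothesis f_ge0 : {ae P, forall x, 0 <= f x}.
Hypothesis f_norm1 : 'N[P]_1[EFin \o f]%E = 1%E.

(** Coefficients are collected by sign, as one sign may occur several times in the combination. *)
Lemma rademacher_span1 q : linear_span [set @rademacher R i | i in [set: nat]] q ->
  exists n b, q = rad1 n b.
Proof.
move=> [n [a [e [eP ->]]]].
have /choice[h hP] : forall i, exists k : nat, @rademacher R k = e i.
  by move=> i; have [k] := eP i; exists k.
exists (\max_i h i).+1, (fun j => \sum_i a i * (h i == j)%:R).
apply/funext => w; rewrite /rad1; under [RHS]eq_bigr do rewrite mulr_suml.
rewrite exchange_big/=; apply: eq_bigr => i _.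
under eq_bigr do rewrite -mulrA.
rewrite -mulr_sumr (sum_delta_ord (fun j => rademacher R j w)) ?hP//.
by rewrite ltnS; exact: leq_bigmax.
Qed.

(** Each product of two signs is shared between the two symmetric entries, whence the factor [2^-1];
    distinct indices keep the diagonal zero. *)
Lemma rademacher_span2 q :
  linear_span [set @rademacher R ij.1 \* rademacher R ij.2
      | ij in [set ij : nat * nat | ij.1 != ij.2]] q ->
  exists n M, [/\ forall i j, M i j = M j i, forall i, M i i = 0 &
    q = (fun w => 2^-1 * rad2 n M w)].
Proof.
move=> [n [a [e [eP ->]]]].
have /choice[h hP] : forall i, exists k : nat * nat, k.1 != k.2 /\
    (@rademacher R k.1 \* rademacher R k.2) = e i.
  by move=> i; have [k] := eP i; exists k.
pose N := (\max_i maxn (h i).1 (h i).2).+1.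
have h1N i : ((h i).1 < N)%N.
  by rewrite ltnS (leq_trans (leq_maxl _ (h i).2))//; exact: (leq_bigmax i).
have h2N i : ((h i).2 < N)%N.
  by rewrite ltnS (leq_trans (leq_maxr (h i).1 _))//; exact: (leq_bigmax i).
pose D i j k : R := ((h i).1 == j)%:R * ((h i).2 == k)%:R.
exists N, (fun j k => \sum_i a i * (D i j k + D i k j)); split=> [j k|j|].
- by apply: eq_bigr => i _; rewrite addrC.
- apply: big1 => i _; have [hN _] := hP i.
  suff -> : D i j j = 0 by rewrite addr0 mulr0.
  rewrite /D; case: eqP => [h1j|_]; last by rewrite mul0r.
  by rewrite mul1r -h1j eq_sym (negbTE hN).
apply/funext => w; rewrite /rad2.
have DE i : \sum_(j < N) \sum_(k < N) D i j k * (rademacher R j w * rademacher R k w) = e i w.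
  have [_ <-] := hP i; rewrite /= -(sum_delta_ord (fun j => rademacher R j w) (h1N i)) mulr_suml.
  apply: eq_bigr => j _; rewrite -(sum_delta_ord (fun j => rademacher R j w) (h2N i)) mulr_sumr.
  by apply: eq_bigr => k _; rewrite /D; ring.
transitivity (2^-1 * \sum_i a i * \sum_(j < N) \sum_(k < N)
    (D i j k * (rademacher R j w * rademacher R k w) + D i k j * (rademacher R k w * rademacher R j w))).
  rewrite mulr_sumr; apply: eq_bigr => i _.
  under eq_bigr do rewrite big_split/=.
  by rewrite big_split/= [X in _ + X]exchange_big/= DE; field.
congr (_ * _).
under eq_bigr do rewrite mulr_sumr; rewrite exchange_big/=; apply: eq_bigr => j _.
under eq_bigr do rewrite mulr_sumr; rewrite exchange_big/=; apply: eq_bigr => k _.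
by rewrite mulr_suml; apply: eq_bigr => i _; ring.
Qed.

Lemma rademacher_chaos1_bound g : is_orth_proj P (rademacher_chaos1 P) f g ->
  ('N[P]_(2%:E)[EFin \o g] <= ((1 + 2^-1) * Num.sqrt (Ent P f))%:E)%E.
Proof.
apply: (proj_norm2_le lf) => [|q /rademacher_span1[n [b ->]]].
  by rewrite mulr_ge0 ?sqrtr_ge0// addr_ge0.
have lq : rad1 n b \in Lfun P 2%:E by exact/tame_Lfun2/tame_rad1.
split => //; apply: (subgaussian_duality lf f_ge0 f_norm1 lq) => // t t0.
exact: rademacher1_mgf.
Qed.

Lemma rademacher_chaos2_bound g : is_orth_proj P (rademacher_chaos2 P) f g ->
  ('N[P]_(2%:E)[EFin \o g] <=
    ((c2^-1 + k2 * c2) * Num.max (Num.sqrt (Ent P f)) (Ent P f))%:E)%E.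
Proof.
have c0 : 0 < c2 by rewrite invr_gt0 mulr_gt0 ?expR_gt0.
have k0 : 0 < k2 by rewrite mulr_gt0 ?exprn_gt0 ?expR_gt0.
apply: (proj_norm2_le lf) => [|q /rademacher_span2[n [M [symM M0 ->]]]].
  apply: mulr_ge0; last by rewrite le_max sqrtr_ge0.
  by apply: addr_ge0; [rewrite invr_ge0 ltW|rewrite mulr_ge0// ltW].
have lq : (fun w => 2^-1 * rad2 n M w) \in Lfun P 2%:E by exact/tame_Lfun2/tameZ/tame_rad2.
split => //; apply: (subexponential_duality lf f_ge0 f_norm1 lq) => // t t0 tc.
exact: rademacher2_mgf.
Qed.

End rademacher_case.

(** * Both cases with common constants *)

Theorem corollary1p4 (R : realType) :
  exists C C' : R, [/\ 0 < C, 0 < C',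
    (* Gaussian case *)
    (forall (H : completeNormedModType R) (ip : {dot H for @idfun R})
        (d : measure_display) (T : measurableType d) (P : probability T R)
        (W : H -> {RV P >-> R}),
      norm_from_dot ip -> separable H -> isonormal W ip ->
      forall f : T -> R, L2 P (sigma_W W) f ->
        {ae P, forall x, 0 <= f x} -> 'N[P]_1[EFin \o f]%E = 1%E ->
        (forall g, is_orth_proj P (wiener_chaos W 1) f g ->
          ('N[P]_(2%:E)[EFin \o g] <= (C * Num.sqrt (Ent P f))%:E)%E) /\
        (forall g, is_orth_proj P (wiener_chaos W 2) f g ->
          ('N[P]_(2%:E)[EFin \o g]
             <= (C' * Num.max (Num.sqrt (Ent P f)) (Ent P f))%:E)%E)) &
    (* Rademacher case *)
    (forall P : probability signs R, uniform_product P ->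
      forall f : signs -> R, L2 P measurable f ->
        {ae P, forall x, 0 <= f x} -> 'N[P]_1[EFin \o f]%E = 1%E ->
        (forall g, is_orth_proj P (rademacher_chaos1 P) f g ->
          ('N[P]_(2%:E)[EFin \o g] <= (C * Num.sqrt (Ent P f))%:E)%E) /\
        (forall g, is_orth_proj P (rademacher_chaos2 P) f g ->
          ('N[P]_(2%:E)[EFin \o g]
             <= (C' * Num.max (Num.sqrt (Ent P f)) (Ent P f))%:E)%E))].
Proof.
pose k2 : R := 4 * expR 1 ^+ 2; pose c2 : R := (2 * expR 1)^-1.
have c0 : 0 < c2 by rewrite invr_gt0 mulr_gt0 ?expR_gt0.
have k0 : 0 < k2 by rewrite mulr_gt0 ?exprn_gt0 ?expR_gt0.
(* The constants of [subgaussian_duality] at [k = 1/2] and of [subexponential_duality] at [k2] and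
   [c2]. *)
exists (1 + 2^-1), (c2^-1 + k2 * c2); split.
- by rewrite addr_gt0.
- by rewrite addr_gt0 ?invr_gt0// mulr_gt0.
- move=> H ip d T P W ipn _ isoW f [lf _] f0 f1; split=> g.
    exact: (wiener_chaos1_bound isoW lf f0 f1).
  exact: (wiener_chaos2_bound ipn isoW lf f0 f1).
- move=> P unifP f [lf _] f0 f1; split=> g.
    exact: (rademacher_chaos1_bound unifP lf f0 f1).
  exact: (rademacher_chaos2_bound unifP lf f0 f1).
Qed.
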